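(* Let $p$ be an odd prime and $n$ a positive integer. There is a deterministic algorithm which, given a Dembowski-Ostrom polynomial $g\in\mathbb{F}_{p^n}[x]$, decides whether $g$ is (extended-affine) equivalent to $x^2\in\mathbb{F}_{p^n}[x]$ using $\mathcal{O}(n^7\log(p))$ elementary operations in $\mathbb{F}_p$ and $\mathcal{O}(n^2)$ evaluations of $g$. Respectively, for a planar Dembowski-Ostrom polynomial $g$ and its associated commutative presemifield $\mathcal{R}_g=(\mathbb{F}_{p^n},+,\star)$, it can be decided deterministically whether $\mathcal{R}_g$ is isotopic to the finite field $\mathbb{F}_{p^n}$ using $\mathcal{O}(n^7\log(p))$ elementary operations in $\mathbb{F}_p$ and $\mathcal{O}(n^2)$ evaluations of $\star$.
   Context: A Dembowski-Ostrom (DO) polynomial in $\mathbb{F}_{p^n}[x]$ is one of the form $\sum_{0\le i\le j\le n-1}u_{i,j}x^{p^i+p^j}$ with $u_{i,j}\in\mathbb{F}_{p^n}$. A linearized polynomial is one of the form $\sum_i u_ix^{p^i}$, $u_i\in\mathbb{F}_{p^n}$; it is a linearized permutation polynomial if its evaluation map on $\mathbb{F}_{p^n}$ is bijective. Two polynomials $g,g'\in\mathbb{F}_{p^n}[x]/(x^{p^n}-x)$ are (extended-affine) equivalent if there exist linearized permutation polynomials $L,L'$, a linearized polynomial $L''$, and $u,v,w\in\mathbb{F}_{p^n}$ with $g'(x)=L'(g(L(x)+u))+v+L''(x)+w \bmod (x^{p^n}-x)$. A polynomial $g$ is planar if for every $\alpha\in\mathbb{F}_{p^n}^*$ the polynomial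 $\Delta_{g,\alpha}(x)=g(x+\alpha)-g(x)-g(\alpha)$ induces a bijection of $\mathbb{F}_{p^n}$. For a planar DO polynomial $g$, $\mathcal{R}_g=(\mathbb{F}_{p^n},+,\star)$ with $a\star b=\Delta_{g,a}(b)$ is a commutative presemifield. Two commutative presemifields $(\mathbb{F}_{p^n},+,\star)$ and $(\mathbb{F}_{p^n},+,\circ)$ are isotopic if there are $\mathbb{F}_p$-linear bijections $A,B,C$ of $\mathbb{F}_{p^n}$ with $A(a)\star B(b)=C(a\circ b)$ for all $a,b$. Elements of $\mathbb{F}_{p^n}$ are represented by coordinate vectors with respect to a fixed $\mathbb{F}_p$-basis; $g$ (resp. $\star$) is accessed by evaluations at elements of $\mathbb{F}_{p^n}$, counted separately. Elementary operations are field operations and comparisons in $\mathbb{F}_p$; constants in $\mathcal{O}$ are absolute. *)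

(* Defs.v *)
(* MathComp. *)
From HB Require Import structures.
From mathcomp Require Import all_boot all_order all_algebra all_field.

Set Implicit Arguments.
Unset Strict Implicit.
Unset Printing Implicit Defensive.

Import GRing.Theory.

(** * Algorithms over a field with an oracle

   An algorithm is one fixed program text for a random access machine with
   integer registers (for control and addressing) and named arrays of field
   elements.  The field, the oracle and the input are only given at run time.
   An integer register never receives a field element; field elements influence
   control only through equality tests. *)

Inductive iexp : Type :=
| IConst of nat
| IReg of nat
| IAdd of iexp & iexp
| ISub of iexp & iexp            (* truncated *)
| IHalf of iexp.

(* [FGet a e] is the cell of array [a] at index [e]. *)
Inductive fexp : Type :=
| FZero
| FOne
| FGet of nat & iexp
| FOpp of fexp
| FAdd of fexp & fexp
| FSub of fexp & fexp
| FMul of fexp & fexp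
| FDiv of fexp & fexp.

Inductive test : Type :=
| TLt of iexp & iexp
| TEq of iexp & iexp
| TFieldEq of fexp & fexp
| TNot of test.

(* [CQuery b a] passes the contents of array [a] to the oracle and writes the
   answer to the first cells of array [b]. *)
Inductive cmd : Type :=
| CSkip
| CSetI of nat & iexp
| CSetF of nat & iexp & fexp
| CQuery of nat & nat
| CSeq of cmd & cmd
| CIf of test & cmd & cmd
| CWhile of test & cmd.

(* Field operations and comparisons, oracle queries, and all the remaining work
   (index arithmetic, memory accesses, assignments, branching) are counted
   separately.  The last counter is there because unlimited index computations
   would be an unlimited source of free computing power. *)
Record cost : Type := Cost {field_ops : nat; control_ops : nat; queries : nat}.

Definition cost0 : cost := Cost 0 0 0.
Definition one_field : cost := Cost 1 0 0.
Definition one_control : cost := Cost 0 1 0.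
Definition one_query : cost := Cost 0 0 1.

Definition addc (k l : cost) : cost :=
  Cost (field_ops k + field_ops l) (control_ops k + control_ops l)
       (queries k + queries l).

Fixpoint icost (e : iexp) : cost :=
  match e with
  | IConst _ | IReg _ => one_control
  | IAdd e1 e2 | ISub e1 e2 => addc one_control (addc (icost e1) (icost e2))
  | IHalf e1 => addc one_control (icost e1)
  end.

Fixpoint fcost (e : fexp) : cost :=
  match e with
  | FZero | FOne => one_control
  | FGet _ i => addc one_control (icost i)
  | FOpp e1 => addc one_field (fcost e1)
  | FAdd e1 e2 | FSub e1 e2 | FMul e1 e2 | FDiv e1 e2 =>
      addc one_field (addc (fcost e1) (fcost e2))
  end.

Fixpoint tcost (t : test) : cost :=
  match t with
  | TLt e1 e2 | TEq e1 e2 => addc one_control (addc (icost e1) (icost e2))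
  | TFieldEq e1 e2 => addc one_field (addc (fcost e1) (fcost e2))
  | TNot t1 => addc one_control (tcost t1)
  end.

Section Semantics.

Variable K : fieldType.

Record state : Type := State {regs : nat -> nat; arrays : nat -> nat -> K}.

Definition upd (T : Type) (f : nat -> T) (i : nat) (v : T) : nat -> T :=
  fun j => if j == i then v else f j.

Fixpoint ieval (s : state) (e : iexp) : nat :=
  match e with
  | IConst k => k
  | IReg r => regs s r
  | IAdd e1 e2 => ieval s e1 + ieval s e2
  | ISub e1 e2 => ieval s e1 - ieval s e2
  | IHalf e1 => (ieval s e1)./2
  end.

Fixpoint feval (s : state) (e : fexp) : K :=
  match e with
  | FZero => 0%R
  | FOne => 1%R
  | FGet a i => arrays s a (ieval s i)
  | FOpp e1 => (- feval s e1)%R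
  | FAdd e1 e2 => (feval s e1 + feval s e2)%R
  | FSub e1 e2 => (feval s e1 - feval s e2)%R
  | FMul e1 e2 => (feval s e1 * feval s e2)%R
  | FDiv e1 e2 => (feval s e1 / feval s e2)%R
  end.

Fixpoint teval (s : state) (t : test) : bool :=
  match t with
  | TLt e1 e2 => ieval s e1 < ieval s e2
  | TEq e1 e2 => ieval s e1 == ieval s e2
  | TFieldEq e1 e2 => feval s e1 == feval s e2
  | TNot t1 => ~~ teval s t1
  end.

Definition set_reg (s : state) (r v : nat) : state :=
  State (upd (regs s) r v) (arrays s).

Definition set_cell (s : state) (a i : nat) (v : K) : state :=
  State (regs s) (upd (arrays s) a (upd (arrays s a) i v)).

Definition set_block (s : state) (a : nat) (w : seq K) : state :=
  State (regs s)
    (upd (arrays s) a (fun i => if i < size w then nth 0%R w i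
                                else arrays s a i)).

Variable oracle : (nat -> K) -> seq K.

(* [exec c s k s']: started in [s], [c] halts in [s'] at cost [k]. *)
Inductive exec : cmd -> state -> cost -> state -> Prop :=
| ExecSkip s : exec CSkip s cost0 s
| ExecSetI r e s :
    exec (CSetI r e) s (addc one_control (icost e)) (set_reg s r (ieval s e))
| ExecSetF a i e s :
    exec (CSetF a i e) s (addc one_control (addc (icost i) (fcost e)))
         (set_cell s a (ieval s i) (feval s e))
| ExecQuery b a s :
    exec (CQuery b a) s (addc one_query one_control)
         (set_block s b (oracle (arrays s a)))
| ExecSeq c1 c2 s1 s2 s3 k1 k2 :
    exec c1 s1 k1 s2 -> exec c2 s2 k2 s3 ->
    exec (CSeq c1 c2) s1 (addc k1 k2) s3
| ExecIf t c1 c2 s s' k :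
    exec (if teval s t then c1 else c2) s k s' ->
    exec (CIf t c1 c2) s (addc one_control (addc (tcost t) k)) s'
| ExecWhileEnd t c s :
    ~~ teval s t ->
    exec (CWhile t c) s (addc one_control (tcost t)) s
| ExecWhileStep t c s1 s2 s3 k1 k2 :
    teval s1 t -> exec c s1 k1 s2 -> exec (CWhile t c) s2 k2 s3 ->
    exec (CWhile t c) s1
         (addc (addc one_control (tcost t)) (addc k1 k2)) s3.

Lemma exec_deterministic c s k s1 l s2 :
  exec c s k s1 -> exec c s l s2 -> k = l /\ s1 = s2.
Proof.
move=> H; elim: H l s2 => {c s k s1}.
- by move=> s l s2 H; inversion H.
- by move=> r e s l s2 H; inversion H.
- by move=> a i e s l s2 H; inversion H.
- by move=> b a s l s2 H; inversion H.
- move=> c1 c2 s1 s2 s3 k1 k2 _ IH1 _ IH2 l s4 H; inversion H; subst.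
  by case: (IH1 _ _ ltac:(eassumption)) => ? ?; subst;
     case: (IH2 _ _ ltac:(eassumption)) => ? ?; subst.
- move=> t c1 c2 s s' k _ IH l s2 H; inversion H; subst.
  by case: (IH _ _ ltac:(eassumption)) => ? ?; subst.
- move=> t c s tF l s2 H; inversion H as [| | | | | | |? ? ? ? ? ? ? tT] => //.
  by rewrite tT in tF.
- move=> t c s1 s2 s3 k1 k2 tT _ IH1 _ IH2 l s4 H.
  inversion H as [| | | | | |? ? ? tF|]; subst; first by rewrite tT in tF.
  by case: (IH1 _ _ ltac:(eassumption)) => ? ?; subst;
     case: (IH2 _ _ ltac:(eassumption)) => ? ?; subst.
Qed.

(* Register 0 holds the answer: nonzero for "yes". *)
Definition decides (c : cmd) (s : state) (P : Prop) (opbound qbound : nat) :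
    Prop :=
  exists (k : cost) (s' : state),
    [/\ exec c s k s', regs s' 0 != 0 <-> P, field_ops k <= opbound,
        control_ops k <= opbound & queries k <= qbound].

End Semantics.

Local Open Scope ring_scope.

(** * Polynomials over F_{p^n}

   F_{p^n} is a field extension of 'F_p with an n-element basis. *)

Section Polynomials.

Variables (p n : nat) (F : fieldExtType 'F_p).

Definition dembowski_ostrom (g : {poly F}) : Prop :=
  exists u : nat -> nat -> F,
    g = \sum_(j < n) \sum_(i < n | (i <= j)%N) u i j *: 'X^(p ^ i + p ^ j).

Definition linearized (L : {poly F}) : Prop :=
  exists (m : nat) (u : nat -> F), L = \sum_(i < m) u i *: 'X^(p ^ i).

Definition linearized_permutation (L : {poly F}) : Prop :=
  linearized L /\ bijective (fun x : F => L.[x]).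

(* Polynomials stand for their classes modulo X^(p^n) - X. *)
Definition ea_equivalent (g g' : {poly F}) : Prop :=
  exists (L L' L'' : {poly F}) (u v w : F),
    [/\ linearized_permutation L, linearized_permutation L', linearized L''
      & g' %% ('X^(p ^ n) - 'X) =
        (L' \Po (g \Po (L + u%:P)) + v%:P + L'' + w%:P) %% ('X^(p ^ n) - 'X)].

Definition delta (g : {poly F}) (a : F) : {poly F} :=
  g \Po ('X + a%:P) - g - (g.[a])%:P.

Definition planar (g : {poly F}) : Prop :=
  forall a : F, a != 0 -> bijective (fun x : F => (delta g a).[x]).

(* The multiplication of the presemifield R_g. *)
Definition star (g : {poly F}) (a b : F) : F := (delta g a).[b].

Definition isotopic (m1 m2 : F -> F -> F) : Prop :=
  exists A B C : {linear F -> F},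
    [/\ bijective A, bijective B, bijective C
      & forall a b : F, m1 (A a) (B b) = C (m2 a b)].

(** * Coordinates, oracles and input *)

Variable e : n.-tuple F.

Definition coords (x : F) : seq 'F_p := [seq coord e k x | k <- enum 'I_n].

Definition vec (a : nat -> 'F_p) : F := \sum_(k < n) a k *: e`_k.

Definition eval_oracle (g : {poly F}) (a : nat -> 'F_p) : seq 'F_p :=
  coords g.[vec a].

(* The operands are stored one after the other, in cells 0 .. n-1 and
   n .. 2n-1. *)
Definition mul_oracle (m : F -> F -> F) (a : nat -> 'F_p) : seq 'F_p :=
  coords (m (vec a) (vec (fun k => a (n + k)%N))).

(* Registers 0 and 1 hold n and p; array 0 holds the multiplication table of
   F_{p^n}: coordinate k of e_i * e_j is in cell (i * n + j) * n + k.
   Everything else is zero. *)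
Definition structure_constants : seq 'F_p :=
  flatten [seq coords (x * y) | x <- e, y <- e].

Definition input : state 'F_p :=
  State (fun r => if r == 0%N then n else if r == 1%N then p else 0%N)
        (fun a i => if a == 0%N then nth 0 structure_constants i else 0).

End Polynomials.

(* Main.v *)
From HB Require Import structures.
Require Import Defs.
From mathcomp Require Import all_boot all_algebra all_fingroup.
From mathcomp Require Import all_solvable all_field.
From mathcomp Require Import zify ring.

(** For a Dembowski-Ostrom polynomial g the map
    star x y = g (x + y) - g x - g y is symmetric and bilinear, and g is
    equivalent to X^2 exactly when star is C (A^-1 x * A^-1 y) for linear
    bijections A and C; for a commutative presemifield this is the same as
    isotopy to the field.  Let L = star e_0.  If L is injective,
    mul x y = L^-1 (star x y) is a commutative multiplication with unit e_0,
    and an isotopy to the field turns mul into the field multiplication.  So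
    star is isotopic to the field if and only if L is injective and mul is
    associative and makes F a field.  The last condition is linear: a finite
    commutative algebra is a field if and only if x^(p^2) = x^p only for
    scalar x, that is, the kernel of phi^2 - phi is a line, where phi is the
    Frobenius matrix.  The algorithm reads star on the basis, computes the
    table of mul by Gauss-Jordan elimination on the n x n^2 matrix whose
    columns are the products e_i star e_j, checks associativity on the basis,
    computes phi by repeated squaring, and runs the elimination again on
    phi^2 - phi with one more row to kill the scalars. *)

Set Implicit Arguments.
Unset Strict Implicit.
Unset Printing Implicit Defensive.

Import GRing.Theory.

(** * Executions with cost bounds *)

Local Open Scope nat_scope.

Section CostedExecution.

Variable K : fieldType.
Variable oracle : (nat -> K) -> seq K.

(** No isomorphism is ever computed. It is enough to certify that [mul] makes the space a field; the
    uniqueness of the finite field of a given order then supplies the maps, inside the correctness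
    proof only. The kernel of phi^2 - phi is tested rather than that of phi - 1, because the latter
    misses nilpotents: in F_p[t]/(t^2) the elements fixed by Frobenius are exactly the scalars. In
    phi^2 - phi one elimination detects nilpotents and nontrivial idempotents together. Both
    questions reduce to one condition, [strongly_isotopic], so a single decision program serves both
    and only the way of querying the oracle differs. Two facts make this possible: commutativity of
    star merges the maps A and B of an isotopy into one, and oddness of p recovers g from star by
    halving star x x. *)

Definition ops (k : cost) : nat := field_ops k + control_ops k.

(** A total-correctness triple with two budgets. Its postcondition may again be a [runs] statement,
    which is how sequences are chained. The sum [ops] is bounded because [decides] gives the same
    bound to both operation counters. *)
Definition runs (c : cmd) (s : state K) (T q : nat) (P : state K -> Prop) :=
  exists k s', [/\ exec oracle c s k s', ops k <= T, queries k <= q & P s'].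

Fixpoint modr (c : cmd) : seq nat :=
  match c with
  | CSetI r _ => [:: r]
  | CSeq c1 c2 | CIf _ c1 c2 => modr c1 ++ modr c2
  | CWhile _ c1 => modr c1
  | _ => [::]
  end.

Fixpoint moda (c : cmd) : seq nat :=
  match c with
  | CSetF a _ _ => [:: a]
  | CQuery b _ => [:: b]
  | CSeq c1 c2 | CIf _ c1 c2 => moda c1 ++ moda c2
  | CWhile _ c1 => moda c1
  | _ => [::]
  end.

(** The frame is syntactic: for a concrete command the side conditions on [modr] and [moda] are
    settled by computation. *)
Definition same_off (c : cmd) (s s' : state K) : Prop :=
  (forall r, r \notin modr c -> regs s' r = regs s r) /\
  (forall a, a \notin moda c -> arrays s' a = arrays s a).

Lemma exec_same_off c s k s' : exec oracle c s k s' -> same_off c s s'.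
Proof.
elim=> {c s k s'} //=.
- by move=> r e s; split=> // r'; rewrite inE /= /upd => /negbTE ->.
- by move=> a i e s; split=> // r'; rewrite inE /= /upd => /negbTE ->.
- by move=> b a s; split=> // r'; rewrite inE /= /upd => /negbTE ->.
- move=> c1 c2 s1 s2 s3 k1 k2 _ [r1 a1] _ [r2 a2]; split=> x /=;
    rewrite mem_cat negb_or => /andP[x1 x2]; first by rewrite r2 ?r1.
  by rewrite a2 ?a1.
- move=> t c1 c2 s s' k _; case: ifP => _ [r1 a1]; split=> x /=;
    rewrite mem_cat negb_or => /andP[x1 x2]; by [apply: r1|apply: a1].
- move=> t c s1 s2 s3 k1 k2 _ _ [r1 a1] _ [r2 a2]; split=> x /= xc;
    [by rewrite r2 ?r1|by rewrite a2 ?a1].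
Qed.

Lemma runs_frame c s T q P :
  runs c s T q P -> runs c s T q (fun s' => same_off c s s' /\ P s').
Proof.
by case=> k [s' [E ? ? ?]]; exists k, s'; split=> //; split=> //;
   apply: exec_same_off E.
Qed.

Lemma runs_weaken c s T q T' q' (P Q : state K -> Prop) :
  runs c s T q P -> T <= T' -> q <= q' ->
  (forall s', same_off c s s' -> P s' -> Q s') -> runs c s T' q' Q.
Proof.
move=> /runs_frame[k [s' [E t1 q1 [so p1]]]] t2 q2 PQ.
exists k, s'; split=> //; [exact: leq_trans t2|exact: leq_trans q2|exact: PQ].
Qed.

Lemma opsD k l : ops (addc k l) = ops k + ops l.
Proof. by rewrite /ops /=; lia. Qed.

Lemma runs_skip s (P : state K -> Prop) : P s -> runs CSkip s 0 0 P.
Proof. by exists cost0, s; split=> //; constructor. Qed.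

Lemma queries_icost e : queries (icost e) = 0.
Proof. by elim: e => //= [? -> ? ->|? -> ? ->]. Qed.

Lemma runs_setI r e s (P : state K -> Prop) :
  P (set_reg s r (ieval s e)) -> runs (CSetI r e) s (1 + ops (icost e)) 0 P.
Proof.
move=> Ps; exists (addc one_control (icost e)), (set_reg s r (ieval s e)).
split=> //; [by constructor|by rewrite opsD|].
by rewrite /= queries_icost.
Qed.

Lemma queries_fcost e : queries (fcost e) = 0.
Proof. by elim: e => //= *; rewrite ?queries_icost; lia. Qed.

Lemma queries_tcost t : queries (tcost t) = 0.
Proof. by elim: t => //= *; rewrite ?queries_icost ?queries_fcost. Qed.

Lemma runs_setF a i e s (P : state K -> Prop) :
  P (set_cell s a (ieval s i) (feval s e)) ->
  runs (CSetF a i e) s (1 + (ops (icost i) + ops (fcost e))) 0 P.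
Proof.
move=> Ps; eexists; eexists; split; [by constructor|by rewrite !opsD| |by []].
by rewrite /= queries_icost queries_fcost.
Qed.

Lemma runs_query b a s (P : state K -> Prop) :
  P (set_block s b (oracle (arrays s a))) -> runs (CQuery b a) s 1 1 P.
Proof. by move=> Ps; eexists; eexists; split; first by constructor. Qed.

Lemma runs_seq c1 c2 s T1 q1 T2 q2 (P : state K -> Prop) :
  runs c1 s T1 q1 (fun s1 => runs c2 s1 T2 q2 P) ->
  runs (CSeq c1 c2) s (T1 + T2) (q1 + q2) P.
Proof.
case=> k1 [s1 [E1 t1 h1 [k2 [s2 [E2 t2 h2 Ps]]]]].
exists (addc k1 k2), s2; split=> //; [by econstructor; eassumption| |].
  by rewrite opsD leq_add.
by rewrite /= leq_add.
Qed.

(** The budgets of the branches are added instead of maximised, so that every budget stays a plain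
    sum. *)
Lemma runs_if t c1 c2 s T1 q1 T2 q2 (P : state K -> Prop) :
  (teval s t -> runs c1 s T1 q1 P) -> (~~ teval s t -> runs c2 s T2 q2 P) ->
  runs (CIf t c1 c2) s (1 + ops (tcost t) + (T1 + T2)) (q1 + q2) P.
Proof.
move=> H1 H2.
have [k [s' [E t1 h1 Ps]]] :
    runs (if teval s t then c1 else c2) s (T1 + T2) (q1 + q2) P.
  case: ifP => [/H1|/negbT/H2] [k [s' [? ? ? ?]]]; exists k, s'; split=> //; lia.
exists (addc one_control (addc (tcost t) k)), s'; split=> //.
- by constructor.
- by rewrite !opsD /=; change (ops one_control) with 1; lia.
- by rewrite /= queries_tcost.
Qed.

Lemma runs_while_end t c s (P : state K -> Prop) :
  ~~ teval s t -> P s -> runs (CWhile t c) s (1 + ops (tcost t)) 0 P.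
Proof.
move=> tF Ps; eexists; eexists; split; [exact: ExecWhileEnd| | |by []].
  by rewrite opsD.
by rewrite /= queries_tcost.
Qed.

Lemma runs_while_step t c s T1 q1 T2 q2 (P : state K -> Prop) :
  teval s t -> runs c s T1 q1 (fun s1 => runs (CWhile t c) s1 T2 q2 P) ->
  runs (CWhile t c) s (1 + ops (tcost t) + (T1 + T2)) (q1 + q2) P.
Proof.
move=> tT [k1 [s1 [E1 t1 h1 [k2 [s2 [E2 t2 h2 Ps]]]]]].
eexists; eexists; split; [exact: ExecWhileStep tT E1 E2| | |by []].
  by rewrite !opsD; change (ops one_control) with 1; lia.
by rewrite /= queries_tcost; lia.
Qed.

End CostedExecution.

(* Register 1 holds p.  Arrays: 1 the matrix under elimination, 2 scalars, 3 to 8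
   oracle arguments and answers, 9 the Frobenius matrix, 10 to 12 vectors. *)
Notation rN := 2 (only parsing).
Notation rN2 := 3 (only parsing).
Notation rSTR := 4 (only parsing).
Notation rFLAG := 5 (only parsing).
Notation rW := 6 (only parsing).
Notation rQ := 7 (only parsing).

(** * Counted loops *)

Definition inc v st := CSetI v (IAdd (IReg v) st).

(* Index expressions have no products, so a loop over [i] also maintains
   [i * STR] and [i * N2] in the two registers after its counter. *)
Definition cfor (v b : nat) (body : cmd) : cmd :=
  CSeq (CSetI v (IConst 0)) (CSeq (CSetI v.+1 (IConst 0))
    (CSeq (CSetI v.+2 (IConst 0))
      (CWhile (TLt (IReg v) (IReg b))
        (CSeq body (CSeq (inc v (IConst 1))
          (CSeq (inc v.+1 (IReg rSTR)) (inc v.+2 (IReg rN2)))))))).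

(** The body may not touch the counters, the bound or the strides, and the counters are distinct
    from the bound, the strides and the flag. The body may change the flag. Being boolean, the
    condition is discharged by evaluation. *)
Definition okfor (v b : nat) (body : cmd) : bool :=
  all (fun r => r \notin modr body) [:: v; v.+1; v.+2; b; rSTR; rN2] &&
  all (fun r => r \notin [:: v; v.+1; v.+2]) [:: b; rSTR; rN2; rFLAG].

(** Each round adds 4 for the test and 4 for each of the three increments, which makes 16; the 10 is
    three initialisations of cost 2 and the final test. *)
Definition Tfor (N T : nat) : nat := N * (T + 16) + 10.

Lemma Tfor_eq N T : Tfor N T = 2 + (2 + (2 + (N * (T + 16) + 4))).
Proof. by rewrite /Tfor; lia. Qed.

Lemma Tfor_step m T :
  4 + (T + (4 + (4 + 4)) + (m * (T + 16) + 4)) <= m.+1 * (T + 16) + 4.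
Proof. by rewrite mulSn; lia. Qed.

Section For.

Variable K : fieldType.
Variable oracle : (nat -> K) -> seq K.
Notation runs := (runs oracle).

(** The invariant sees only the arrays and the flag: the counters have prescribed values in each
    round, and the registers that the loop leaves alone are recovered from [same_off]. *)
Lemma runs_for v b body (s : state K) T q
    (I : nat -> (nat -> nat -> K) -> nat -> Prop) (P : state K -> Prop) :
  okfor v b body ->
  I 0 (arrays s) (regs s rFLAG) ->
  (forall i s1, i < regs s b -> same_off (cfor v b body) s s1 ->
     regs s1 v = i -> regs s1 v.+1 = i * regs s rSTR ->
     regs s1 v.+2 = i * regs s rN2 -> I i (arrays s1) (regs s1 rFLAG) ->
     runs body s1 T q (fun s2 => I i.+1 (arrays s2) (regs s2 rFLAG))) ->
  (forall s1, same_off (cfor v b body) s s1 ->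
     regs s1 v.+1 = regs s b * regs s rSTR ->
     I (regs s b) (arrays s1) (regs s1 rFLAG) -> P s1) ->
  runs (cfor v b body) s (Tfor (regs s b) T) (regs s b * q) P.
Proof.
set c := cfor v b body.
case/andP; rewrite /= !inE !andbT.
case/and5P=> bv bv1 bv2 bb /andP[bst bn2].
rewrite !negb_or; case/and4P=> /and3P[nb0 nb1 nb2] /and3P[ns0 ns1 ns2]
  /and3P[nn0 nn1 nn2] /and3P[nf0 nf1 nf2].
move=> I0 Ib IP; set N := regs s b.
set J := fun i s1 => [/\ same_off c s s1, regs s1 v = i,
  regs s1 v.+1 = i * regs s rSTR, regs s1 v.+2 = i * regs s rN2
  & I i (arrays s1) (regs s1 rFLAG)].
pose w := CWhile (TLt (IReg v) (IReg b)) (CSeq body (CSeq (inc v (IConst 1))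
  (CSeq (inc v.+1 (IReg rSTR)) (inc v.+2 (IReg rN2))))).
have modc : modr c = [:: v, v.+1, v.+2 & modr body ++ [:: v; v.+1; v.+2]] by [].
have modac : moda c = moda body.
  by rewrite /c /=; rewrite cats0.
have notc r : r \notin modr body -> r \notin [:: v; v.+1; v.+2] -> r \notin modr c.
  move=> /negbTE rb /negbTE rv; rewrite modc !inE mem_cat.
  move: rv; rewrite rb !inE => rv /=.
  by move: rv; case: (r == v); case: (r == v.+1); case: (r == v.+2).
have bc : b \notin modr c by apply: notc; rewrite // !inE !negb_or nb0 nb1.
have stc : rSTR \notin modr c.
  by apply: notc; rewrite // !inE !negb_or ns0 ns1.
have n2c : rN2 \notin modr c.
  by apply: notc; rewrite // !inE !negb_or nn0 nn1.
have loop m s1 i : i + m = N -> J i s1 ->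
    runs w s1 (m * (T + 16) + 4) (m * q) P.
  elim: m s1 i => [|m IH] s1 i.
    rewrite addn0 => {i}-> [so e0 e1 e2 II].
    apply: (runs_weaken (T := 4) (q := 0) (P := P)) => //.
    apply: runs_while_end; last exact: IP.
    by rewrite /= e0 (so.1 _ bc) ltnn.
  move=> im [so e0 e1 e2 II].
  have iN : i < N by rewrite -im -addSnnS leq_addr.
  pose T1 := T + (4 + (4 + 4)).
  suff H : runs w s1 (4 + (T1 + (m * (T + 16) + 4))) (q + 0 + m * q) P.
    apply: runs_weaken H _ _ _ => //; first exact: Tfor_step.
    by rewrite addn0 mulSn.
  apply: (@runs_while_step _ _ _ _ s1 T1 (q+0) _ (m * q)).
    by rewrite /= e0 (so.1 _ bc).
  apply: (@runs_seq _ _ _ _ _ T q (4 + (4 + 4)) 0).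
  apply: (runs_weaken (Ib _ _ iN so e0 e1 e2 II)) => // s2 sob I2.
  apply: (@runs_seq _ _ _ _ _ 4 0 (4 + 4) 0).
  apply: runs_setI.
  apply: (@runs_seq _ _ _ _ _ 4 0 4 0).
  apply: runs_setI.
  apply: runs_setI.
  apply: (IH _ i.+1); first by rewrite addSnnS.
  rewrite /J /= /upd !eqxx /=.
  have lt1 : (v.+1 == v) = false by rewrite gtn_eqF.
  have lt2 : (v.+2 == v) = false by rewrite gtn_eqF.
  have lt3 : (v == v.+1) = false by rewrite ltn_eqF.
  have lt4 : (v == v.+2) = false by rewrite ltn_eqF.
  have lt5 : (v.+1 == v.+2) = false by rewrite ltn_eqF.
  have lt6 : (v.+2 == v.+1) = false by rewrite gtn_eqF.
  rewrite !(lt1, lt2, lt3, lt4, lt5, lt6) !(negbTE ns0, negbTE ns1, negbTE ns2,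
      negbTE nn0, negbTE nn1, negbTE nn2, negbTE nf0, negbTE nf1, negbTE nf2).
  rewrite !(sob.1 _ bv, sob.1 _ bv1, sob.1 _ bv2, sob.1 _ bst, sob.1 _ bn2).
  rewrite e0 e1 e2 (so.1 _ stc) (so.1 _ n2c); rewrite addn1 !mulSn ![_ + regs s
      _]addnC; split=> //.
  split=> x xc /=.
    have [] : [/\ x \notin modr body, x != v, x != v.+1 & x != v.+2].
      move: (xc); rewrite modc !inE mem_cat !negb_or -?andbA.
      by case/and5P=> -> -> -> ->.
    by move=> xb /negbTE d0 /negbTE d1 /negbTE d2; rewrite /= /upd d0 d1 d2 sob.1
        // so.1.
  by rewrite sob.2 ?so.2 // -modac.
suff: runs c s (2 + (2 + (2 + (N * (T + 16) + 4)))) (0 + (0 + (0 + N * q))) P.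
  by move=> H; apply: runs_weaken H _ _ _ => //; rewrite -Tfor_eq.
apply: runs_seq; apply: runs_setI.
apply: runs_seq; apply: runs_setI.
apply: runs_seq; apply: runs_setI.
apply: (loop N _ 0) => //.
rewrite /J /= /upd !eqxx !(negbTE nf0, negbTE nf1, negbTE nf2) /=.
have lt1 : (v.+1 == v) = false by rewrite gtn_eqF.
have lt3 : (v == v.+1) = false by rewrite ltn_eqF.
have lt4 : (v == v.+2) = false by rewrite ltn_eqF.
have lt5 : (v.+1 == v.+2) = false by rewrite ltn_eqF.
rewrite !(lt1, lt3, lt4, lt5); split=> //.
split=> // r.
by rewrite modc !inE mem_cat !negb_or -?andbA /= /upd =>
  /and5P[/negbTE-> /negbTE-> /negbTE-> _ _].
Qed.

End For.

Section DerivedRules.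

Variable K : fieldType.
Variable oracle : (nat -> K) -> seq K.
Notation runs := (runs oracle).

Lemma runs_cost c (s : state K) T q T' q' P :
  runs c s T q P -> T <= T' -> q <= q' -> runs c s T' q' P.
Proof. by move=> H h1 h2; apply: runs_weaken H h1 h2 _. Qed.

Lemma runs_imp c (s : state K) T q (P Q : state K -> Prop) :
  runs c s T q P -> (forall s', same_off c s s' -> P s' -> Q s') ->
  runs c s T q Q.
Proof. by move=> H h1; apply: runs_weaken H _ _ h1. Qed.

Lemma runs_forN N v b body (s : state K) T q
    (I : nat -> (nat -> nat -> K) -> nat -> Prop) (P : state K -> Prop) :
  okfor v b body -> regs s b = N ->
  I 0 (arrays s) (regs s rFLAG) ->
  (forall i s1, i < N -> same_off (cfor v b body) s s1 ->
     regs s1 v = i -> regs s1 v.+1 = i * regs s rSTR ->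
     regs s1 v.+2 = i * regs s rN2 -> I i (arrays s1) (regs s1 rFLAG) ->
     runs body s1 T q (fun s2 => I i.+1 (arrays s2) (regs s2 rFLAG))) ->
  (forall s1, same_off (cfor v b body) s s1 ->
     regs s1 v.+1 = N * regs s rSTR ->
     I N (arrays s1) (regs s1 rFLAG) -> P s1) ->
  runs (cfor v b body) s (Tfor N T) (N * q) P.
Proof. by move=> ok <-; apply: runs_for. Qed.

Lemma runs_for0 N v b body (s : state K) T
    (I : nat -> (nat -> nat -> K) -> nat -> Prop) (P : state K -> Prop) :
  okfor v b body -> regs s b = N ->
  I 0 (arrays s) (regs s rFLAG) ->
  (forall i s1, i < N -> same_off (cfor v b body) s s1 ->
     regs s1 v = i -> regs s1 v.+1 = i * regs s rSTR ->
     regs s1 v.+2 = i * regs s rN2 -> I i (arrays s1) (regs s1 rFLAG) ->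
     runs body s1 T 0 (fun s2 => I i.+1 (arrays s2) (regs s2 rFLAG))) ->
  (forall s1, same_off (cfor v b body) s s1 ->
     regs s1 v.+1 = N * regs s rSTR ->
     I N (arrays s1) (regs s1 rFLAG) -> P s1) ->
  runs (cfor v b body) s (Tfor N T) 0 P.
Proof.
move=> ok Nb I0 Ib IP; apply: (runs_cost (runs_forN ok Nb I0 Ib IP)) => //.
by rewrite muln0.
Qed.

End DerivedRules.

(** * Gaussian elimination *)

Local Open Scope nat_scope.

Lemma cell_inj R c r c' r' : r < R -> r' < R ->
  (c * R + r == c' * R + r') = (c == c') && (r == r').
Proof.
move=> rR r'R; apply/eqP/andP => [E|[/eqP-> /eqP->]] //.
have R0 : 0 < R by lia.
have := congr1 (divn^~ R) E; rewrite !divnMDl // !divn_small // !addn0 => ->.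
by have := congr1 (modn^~ R) E; rewrite !modnMDl !modn_small // => ->; rewrite !eqxx.
Qed.

(* Array 1 holds a matrix by columns: entry (r, c) is in cell [c * STR + r].
   The two coefficients of the row operation are in array 2. *)
Definition rowop (i j : nat) : cmd :=
  cfor 19 rW (CSetF 1 (IAdd (IReg 20) (IReg i))
    (FAdd (FMul (FGet 2 (IConst 0)) (FGet 1 (IAdd (IReg 20) (IReg i))))
          (FMul (FGet 2 (IConst 1)) (FGet 1 (IAdd (IReg 20) (IReg j)))))).

Section RowOp.

Variable K : fieldType.
Variable oracle : (nat -> K) -> seq K.
Notation runs := (runs oracle).

(** Each column is visited once and both entries are read before the write, so the formula also
    holds for [i = j]; this case scales the pivot row. *)
Lemma rowop_runs i j (s : state K) W R :
  regs s rW = W -> regs s rSTR = R -> regs s i < R -> regs s j < R ->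
  i \notin [:: 19; 20; 21] -> j \notin [:: 19; 20; 21] ->
  runs (rowop i j) s (Tfor W 40) 0 (fun s' => forall c r, c < W -> r < R ->
    arrays s' 1 (c * R + r) =
      if r == regs s i then
        (arrays s 2 0 * arrays s 1 (c * R + r)
          + arrays s 2 1 * arrays s 1 (c * R + regs s j))%R
      else arrays s 1 (c * R + r)).
Proof.
move=> sW sR iR jR ni nj.
pose I k (A : nat -> nat -> K) (f : nat) := forall c r, c < W -> r < R ->
  A 1 (c * R + r) =
  if (r == regs s i) && (c < k) then
    (arrays s 2 0 * arrays s 1 (c * R + r)
          + arrays s 2 1 * arrays s 1 (c * R + regs s j))%R
      else arrays s 1 (c * R + r).
apply: (runs_for0 (I := I)) => //.
- by move=> c r _ _; rewrite ltn0 andbF.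
- move=> k s1 kW so e0 e1 e2 II.
  have kept x : x \notin [:: 19; 20; 21] -> regs s1 x = regs s x.
    move=> nx; apply: so.1; move: nx; rewrite /= !inE !negb_or.
    by case/and3P=> -> -> ->.
  have ri : regs s1 i = regs s i by apply: kept.
  have rj : regs s1 j = regs s j by apply: kept.
  have a2 : arrays s1 2 = arrays s 2 by apply: so.2.
  apply: (runs_cost (runs_setF _ _)) => // c r cW rR; rewrite /= e1 sR ri rj a2.
  rewrite /upd eqxx cell_inj //.
  have [->|ck] /= := eqVneq c k.
    have [->|rk] /= := eqVneq r (regs s i); last by rewrite II // (negbTE rk).
    by rewrite leqnn !II // eqxx ltnn /= andbF.
  by rewrite II // ltnS [c <= k]leq_eqVlt (negbTE ck).
- move=> s1 so _ II c r cW rR; rewrite II // cW andbT //.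
Qed.

End RowOp.

(** * Row operations and the right kernel *)

Section Kernel.

Variable K : fieldType.
Local Open Scope ring_scope.

(* Elimination is specified by the preservation of the right kernel, which
   spares the matrix of row operations. *)
Definition in_kernel (R W : nat) (A x : nat -> K) : Prop :=
  forall r, (r < R)%N -> \sum_(c < W) x c * A (c * R + r)%N = 0.

(** The row sums [S A r] undergo the same operation as the rows, and it is reversible because [t0]
    is invertible. For [i = j] the factor would be [t0 + t1], which could vanish, hence the
    condition [t1 = 0]. *)
Lemma in_kernel_rowop (R W : nat) (A B : nat -> K) (i j : nat) (t0 t1 : K) :
  (i < R)%N -> (j < R)%N -> t0 != 0 -> (i == j) ==> (t1 == 0) ->
  (forall c r, (c < W)%N -> (r < R)%N -> B (c * R + r)%N =
     if r == i then t0 * A (c * R + r)%N + t1 * A (c * R + j)%N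
     else A (c * R + r)%N) ->
  forall x, in_kernel R W B x <-> in_kernel R W A x.
Proof.
move=> iR jR t00 ij BA x.
pose S (A : nat -> K) r := \sum_(c < W) x c * A (c * R + r)%N.
have SB r : (r < R)%N ->
    S B r = if r == i then t0 * S A r + t1 * S A j else S A r.
  move=> rR; rewrite /S; case: ifP => ri; last first.
    by apply: eq_bigr => c _; rewrite BA // ri.
  rewrite !mulr_sumr -big_split; apply: eq_bigr => c _ /=; rewrite BA // ri.
  by ring.
split=> H r rR.
  have Hj : i != j -> S A j = 0.
    by move=> nij; rewrite -(H _ jR) -[RHS]/(S B j) SB // eq_sym (negbTE nij).
  have := SB _ rR; rewrite {1}/S H //; have [->|//] := eqVneq r i.
  rewrite -[\sum_(_ < _) _]/(S A i); have [Eij|nij] := eqVneq i j.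
    move: ij; rewrite Eij eqxx => /eqP->; rewrite mul0r addr0.
    by move/esym/eqP; rewrite mulf_eq0 (negbTE t00) => /eqP.
  rewrite Hj // mulr0 addr0.
  by move/esym/eqP; rewrite mulf_eq0 (negbTE t00) => /eqP.
by rewrite -[LHS]/(S B r) SB // /S !H // !mulr0 addr0 if_same.
Qed.

End Kernel.

Local Open Scope nat_scope.

Definition pivot : fexp := FGet 1 (IAdd (IReg 11) (IReg 10)).

(** Rows are not swapped. While the pivot entry is zero, the next row below is added to the pivot
    row; once it is nonzero the test fails in all later rounds. *)
Definition find_pivot : cmd :=
  cfor 13 rSTR
    (CIf (TLt (IReg 10) (IReg 13))
       (CIf (TFieldEq pivot FZero) (rowop 10 13) CSkip) CSkip).

Definition clear_column : cmd :=
  cfor 13 rSTR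
    (CIf (TEq (IReg 13) (IReg 10)) CSkip
      (CSeq (CSetF 2 (IConst 0) FOne)
        (CSeq (CSetF 2 (IConst 1) (FOpp (FGet 1 (IAdd (IReg 11) (IReg 13)))))
          (rowop 13 10)))).

(** A loop cannot be left early, so after a missing pivot the cleared flag turns the remaining
    rounds into no-ops. *)
Definition gauss_step : cmd :=
  CIf (TEq (IReg rFLAG) (IConst 0)) CSkip
   (CSeq (CSetF 2 (IConst 0) FOne)
    (CSeq (CSetF 2 (IConst 1) FOne)
     (CSeq find_pivot
      (CIf (TFieldEq pivot FZero) (CSetI rFLAG (IConst 0))
       (CSeq (CSetF 2 (IConst 0) (FDiv FOne pivot))
        (CSeq (CSetF 2 (IConst 1) FZero)
         (CSeq (rowop 10 10) clear_column))))))).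

(** Only the first [n] columns are pivoted, and a missing pivot among them already settles the
    answer. Hence no column is skipped, pivot [j] sits in row [j], and the other columns are carried
    along as right-hand sides. *)
Definition gauss : cmd := cfor 10 rN gauss_step.

Definition Tgauss (n R W : nat) : nat :=
  Tfor n (100 + (Tfor R (60 + Tfor W 40) + (Tfor W 40 + Tfor R (60 + Tfor W 40)))).

Section Gauss.

Variable K : fieldType.
Variable oracle : (nat -> K) -> seq K.
Notation runs := (runs oracle).
Local Open Scope ring_scope.

Definition reduced (j R : nat) (A : nat -> K) : Prop :=
  forall c r, (c < j)%N -> (r < R)%N -> A (c * R + r)%N = (r == c)%:R.

Definition dependent (j R W : nat) (A : nat -> K) : Prop :=
  exists x : nat -> K, [/\ in_kernel R W A x,
    forall c, (j <= c)%N -> x c = 0 & exists2 c, (c < j)%N & x c != 0].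

Definition same_kernel (R W : nat) (A B : nat -> K) : Prop :=
  forall x, in_kernel R W A x <-> in_kernel R W B x.

Lemma same_kernel_trans R W A B C :
  same_kernel R W A B -> same_kernel R W B C -> same_kernel R W A C.
Proof. by move=> h1 h2 x; rewrite h1. Qed.

Lemma find_pivot_runs (s : state K) j R W :
  regs s 10 = j -> regs s 11 = (j * R)%N -> regs s rSTR = R -> regs s rW = W ->
  (j < R)%N -> (j < W)%N ->
  arrays s 2 0%N = 1 -> arrays s 2 1%N = 1 -> reduced j R (arrays s 1) ->
  runs find_pivot s (Tfor R (60 + Tfor W 40)) 0 (fun s' =>
    [/\ same_kernel R W (arrays s' 1) (arrays s 1), reduced j R (arrays s' 1)
      & arrays s' 1 (j * R + j)%N = 0 ->
        forall r, (j < r < R)%N -> arrays s' 1 (j * R + r)%N = 0]).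
Proof.
move=> s10 s11 sR sW jR jW s20 s21 red.
pose I k (A : nat -> nat -> K) (f : nat) := [/\ A 2 = arrays s 2,
  same_kernel R W (A 1%N) (arrays s 1), reduced j R (A 1%N)
      & A 1%N (j * R + j)%N = 0 ->
        forall r, (j < r < R)%N -> (r < k)%N -> A 1%N (j * R + r)%N = 0].
apply: (runs_for0 (I := I)) => //; last first.
  move=> s1 so _ [_ h1 h2 h3]; split=> // z r rj; apply: h3 => //.
  by case/andP: rj.
move=> k s1 kR so e0 e1 e2 [I1 I2 I3 I4].
have r10 : regs s1 10 = j by rewrite so.1.
have r11 : regs s1 11 = (j * R)%N by rewrite so.1.
have r4 : regs s1 rSTR = R by rewrite so.1.
have r6 : regs s1 rW = W by rewrite so.1.
apply: (runs_cost (T := 4 + ((1 + 6 + (Tfor W 40 + 0)) + 0)) (q := 0)) => //;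
  last by lia.
apply: (runs_if (T1 := 1 + 6 + (Tfor W 40 + 0)) (q1 := 0) (T2 := 0) (q2 := 0)) => /=;
  rewrite r10 e0 => jk; last first.
  apply: runs_skip; split=> // z r rj; rewrite ltnS leq_eqVlt.
  by case/orP => [/eqP rk|]; [lia|apply: I4].
apply: (runs_if (T1 := Tfor W 40) (q1 := 0) (T2 := 0) (q2 := 0)) => /=;
  rewrite r11 r10 => jj; last first.
  by apply: runs_skip; split=> // z; rewrite z eqxx in jj.
apply: (runs_imp (rowop_runs (W := W) (R := R) _ _ _ _ _ _ _)); rewrite ?r10 ?e0 //.
move=> s2 so2 E; split; first by rewrite so2.2.
- apply: same_kernel_trans I2 => x; apply: (in_kernel_rowop (i := j) (j := k)) E _;
    rewrite ?I1 ?s20 ?s21 ?oner_eq0 //.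
  by apply/implyP => /eqP; lia.
- move=> c r cj rR; rewrite E //; last by lia.
  case: eqP => [->|_]; last exact: I3.
  (* Row [k] lies below row [j], so it is zero in every reduced column and adding it changes nothing
     there. *)
  rewrite I1 s20 s21 !mul1r !I3 //.
  by rewrite [k == c]gtn_eqF ?addr0 //; lia.
- rewrite E // eqxx I1 s20 s21 !mul1r (eqP jj) add0r => z r rj.
  have rR : (r < R)%N by case/andP: rj.
  rewrite ltnS leq_eqVlt E //.
  have -> : (r == j) = false by apply/negbTE; lia.
  by case/orP => [/eqP->//|rk]; apply: I4 => //; apply/eqP.
Qed.

Lemma clear_column_runs (s : state K) j R W :
  regs s 10 = j -> regs s 11 = (j * R)%N -> regs s rSTR = R -> regs s rW = W ->
  (j < R)%N -> (j < W)%N ->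
  arrays s 1 (j * R + j)%N = 1 -> reduced j R (arrays s 1) ->
  runs clear_column s (Tfor R (60 + Tfor W 40)) 0 (fun s' =>
    same_kernel R W (arrays s' 1) (arrays s 1) /\ reduced j.+1 R (arrays s' 1)).
Proof.
move=> s10 s11 sR sW jR jW sjj red.
pose I k (A : nat -> nat -> K) (f : nat) := [/\
  same_kernel R W (A 1%N) (arrays s 1), reduced j R (A 1%N),
  A 1%N (j * R + j)%N = 1
      & forall r, (r < R)%N -> r != j -> (r < k)%N -> A 1%N (j * R + r)%N = 0].
apply: (runs_for0 (I := I)) => //; last first.
  move=> s1 so _ [h1 h2 h3 h4]; split=> // c r.
  rewrite ltnS leq_eqVlt => /orP[/eqP->|cj] rR; last exact: h2.
  by case: eqP => [->//|/eqP rj]; rewrite h4.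
move=> k s1 kR so e0 e1 e2 [I1 I2 I3 I4].
have r10 : regs s1 10 = j by rewrite so.1.
have r11 : regs s1 11 = (j * R)%N by rewrite so.1.
have r4 : regs s1 rSTR = R by rewrite so.1.
have r6 : regs s1 rW = W by rewrite so.1.
apply: (runs_cost (T := 4 + (0 + (3 + (10 + Tfor W 40)))) (q := 0)) => //;
  last by lia.
apply: (runs_if (T2 := 3 + (10 + Tfor W 40)) (q1 := 0) (T1 := 0) (q2 := 0)) => /=;
  rewrite r10 e0 => jk.
  apply: runs_skip; split=> // r rR rj; rewrite ltnS leq_eqVlt.
  by case/orP => [/eqP rk|]; [lia|apply: I4].
apply: (runs_seq (q1 := 0) (q2 := 0)); apply: runs_setF.
apply: (runs_seq (q1 := 0) (q2 := 0)).
apply: (runs_cost (runs_setF _ _)) => //.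
apply: (runs_imp (rowop_runs (W := W) (R := R) _ _ _ _ _ _ _)); rewrite /= ?r10 ?e0 //.
rewrite /upd /= r11 ?e0 ?r10.
move=> s2 so2 E; split.
- apply: same_kernel_trans I1 => x; apply: (in_kernel_rowop (i := k) (j := j)) E _;
    rewrite ?oner_eq0 //.
  by rewrite (negbTE jk).
- move=> c r cj rR; rewrite E //; last by lia.
  case: eqP => [->|_]; last exact: I2.
  rewrite !(I2 c) //.
  by rewrite [j == c]gtn_eqF // mulr0 addr0 mul1r.
- by rewrite E // [j == k]eq_sym (negbTE jk).
- move=> r rR rj; rewrite ltnS E //; case: eqP => [->|/eqP rk] rk'.
    by rewrite I3 mul1r mulr1 subrr.
  by apply: I4 => //; lia.
Qed.

Lemma gauss_runs (s : state K) n R W :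
  regs s rN = n -> regs s rSTR = R -> regs s rW = W -> regs s rFLAG = 1%N ->
  (n <= R)%N -> (n <= W)%N ->
  runs gauss s (Tgauss n R W) 0 (fun s' =>
    [/\ regs s' rFLAG = 1%N, same_kernel R W (arrays s' 1) (arrays s 1)
      & reduced n R (arrays s' 1)]
    \/ regs s' rFLAG = 0%N /\ dependent n R W (arrays s 1)).
Proof.
move=> sn sR sW sF nR nW.
pose I j (A : nat -> nat -> K) (f : nat) :=
    [/\ f = 1%N, same_kernel R W (A 1%N) (arrays s 1)
      & reduced j R (A 1%N)]
    \/ f = 0%N /\ dependent n R W (arrays s 1).
apply: (runs_for0 (I := I)) => //; first by left.
move=> j s1 jn so e0 e1 _ II.
have jR : (j < R)%N by lia.
have jW : (j < W)%N by lia.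
have r4 : regs s1 rSTR = R by rewrite so.1.
have r6 : regs s1 rW = W by rewrite so.1.
rewrite sR in e1.
set TS := Tfor R (60 + Tfor W 40).
apply: (runs_cost (T := 1 + 3 + (0 + (3 + (3 + (TS + (7 + (2 + (10 + (3 + (Tfor W
    40 + TS)))))))))) (q := 0)) => //; last by lia.
apply: (runs_if (T1 := 0) (q1 := 0) (q2 := 0)) => /= fl.
  by apply: runs_skip; case: II => [[f1]|II]; [rewrite f1 in fl|right].
case: II => [[f1 I1 I2]|[f1]]; last by rewrite f1 in fl.
apply: (runs_seq (q1 := 0) (q2 := 0)); apply: runs_setF.
apply: (runs_seq (q1 := 0) (q2 := 0)); apply: runs_setF.
apply: (runs_seq (q1 := 0) (q2 := 0)).
apply: (runs_imp (find_pivot_runs (j := j) (R := R) (W := W) _ _ _ _ _ _ _ _ _)) => //.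
move=> s2 so2 [J1 J2 J3].
have r10 : regs s2 10 = j by rewrite so2.1.
have r11 : regs s2 11 = (j * R)%N by rewrite so2.1.
have r4' : regs s2 rSTR = R by rewrite so2.1.
have r6' : regs s2 rW = W by rewrite so2.1.
have r5' : regs s2 5 = 1%N by rewrite so2.1.
apply: (runs_if (T1 := 2) (q1 := 0) (q2 := 0)) => /=; rewrite r11 r10 => pv.
  apply: runs_setI; right; split=> //.
  (* Column [j] vanishes from row [j] downwards and the columns before it are unit vectors, so it is
     their combination with its own entries as coefficients. *)
  exists (fun c => if c == j then 1 else if (c < j)%N then - arrays s2 1 (j * R +
      c)%N else 0).
  split.
  - apply/I1/J1 => r rR.
    rewrite -(big_mkord xpredT (fun c => (if c == j then 1 else if (c < j)%N then -
        arrays s2 1 (j * R + c)%N else 0) * arrays s2 1 (c * R + r)%N)).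
    rewrite (big_cat_nat (n := j)) //=; last by lia.
    rewrite (@big_ltn _ _ _ j) //= eqxx mul1r.
    rewrite [X in _ + (_ + X)]big1_seq ?addr0; last first.
      move=> c; rewrite mem_index_iota => /andP[_ cj].
      rewrite gtn_eqF; last by lia.
      by rewrite ltnNge leq_eqVlt (_ : (j < c)%N) ?orbT ?mul0r //; lia.
    have -> : \sum_(0 <= c < j) (if c == j then 1 else if (c < j)%N then - arrays
        s2 1 (j * R + c)%N else 0) * arrays s2 1 (c * R + r)%N
       = \sum_(0 <= c < j) - (if c == r then arrays s2 1 (j * R + c)%N else 0).
      apply: eq_big_nat => c /andP[_ cj]; rewrite ltn_eqF // cj (J2 c) // eq_sym.
      by case: eqP; rewrite ?mulr1 ?mulr0 ?oppr0.
    rewrite sumrN -big_mkcond /=.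
    have [rj|jr] := ltnP r j.
      rewrite big_mkord (big_pred1 (Ordinal rj)) //.
      by rewrite addNr.
    rewrite big_nat_cond big_pred0 ?oppr0 ?add0r.
      move: jr; rewrite leq_eqVlt => /orP[/eqP<-|jr]; first exact/eqP.
      by apply: J3; [apply/eqP|rewrite jr].
    by move=> c; apply/negbTE; lia.
  - by move=> c nc; rewrite gtn_eqF ?ltnNge ?(leq_trans (ltnW jn)) //; lia.
  - by exists j => //; rewrite eqxx oner_eq0.
apply: (runs_seq (T1 := 10) (q1 := 0) (q2 := 0)).
apply: (runs_cost (runs_setF _ _)) => //.
apply: (runs_seq (q1 := 0) (q2 := 0)); apply: runs_setF.
apply: (runs_seq (q1 := 0) (q2 := 0)).
apply: (runs_imp (rowop_runs (W := W) (R := R) _ _ _ _ _ _ _)); rewrite /= ?r10 //.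
rewrite /upd /= r11 ?r10 => s3 so3 E.
have sk3 : same_kernel R W (arrays s3 1) (arrays s2 1).
  move=> x; apply: (in_kernel_rowop (i := j) (j := j)) E _; rewrite ?mul1r
      ?invr_eq0 ?eqxx //.
have E' c : (c < W)%N -> arrays s3 1 (c * R + j)%N = arrays s2 1 (c * R + j)%N /
    arrays s2 1 (j * R + j)%N.
  by move=> cW; rewrite E // eqxx mul0r addr0 mul1r mulrC.
apply: (runs_imp (clear_column_runs (j := j) (R := R) (W := W) _ _ _ _ _ _ _ _)) => //.
- by rewrite so3.1.
- by rewrite so3.1.
- by rewrite so3.1.
- by rewrite so3.1.
- by rewrite E' // divff.
- move=> c r cj rR; have [->|rj] := eqVneq r j.
    by rewrite E' ?(J2 c) // ?gtn_eqF ?mul0r //; lia.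
  by rewrite E ?(negbTE rj) ?J2 //; lia.
move=> s4 so4 [h1 h2]; left; split=> //.
  by rewrite so4.1 // so3.1.
apply: same_kernel_trans h1 _; apply: same_kernel_trans sk3 _.
exact: same_kernel_trans J1 _.
Qed.

End Gauss.

(** * Associativity and the Frobenius matrix *)

Local Open Scope nat_scope.

Definition cube_index (v1 v2 v3 : nat) : iexp :=
  IAdd (IAdd (IReg v1.+2) (IReg v2.+1)) (IReg v3).

(** This is also row [k] of column [i * n + j] in an [n] by [n * n] matrix stored by columns, so the
    table of products can be eliminated in place. The first [n] columns are the products with
    [e_0]. *)
Definition cell3 (n i j k : nat) : nat := i * (n * n) + j * n + k.

Lemma cell3_inj n i j k i' j' k' : j < n -> j' < n -> k < n -> k' < n ->
  (cell3 n i j k == cell3 n i' j' k') = [&& i == i', j == j' & k == k'].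
Proof.
have E a b c : cell3 n a b c = (a * n + b) * n + c by rewrite /cell3; nia.
by move=> *; rewrite !E !cell_inj // andbA.
Qed.

Section Loops.

Variable K : fieldType.
Variable oracle : (nat -> K) -> seq K.
Notation runs := (runs oracle).

Definition sized (n : nat) (s : state K) : Prop :=
  [/\ regs s rN = n, regs s rSTR = n & regs s rN2 = n * n].

Lemma sized_same_off n c s s' : sized n s -> same_off c s s' ->
  rN \notin modr c -> rSTR \notin modr c -> rN2 \notin modr c -> sized n s'.
Proof. by case=> h1 h2 h3 so n1 n2 n3; split; rewrite so.1. Qed.

Lemma sized_for n v body (s s1 : state K) : okfor v rN body -> sized n s ->
  same_off (cfor v rN body) s s1 -> sized n s1.
Proof.
move=> ok [h1 h2 h3] so.
case/andP: ok => /=; rewrite !inE.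
rewrite !negb_or andbT => /and5P[b1 b2 b3 b4 /andP[b5 b6]].
case/and5P=> /and3P[c1 c2 c3] /and3P[c4 c5 c6] /and3P[c7 c8 c9] _ _.
split; rewrite so.1 //= ?inE ?mem_cat ?inE !negb_or.
- by rewrite b4 c1 c2 c3.
- by rewrite b5 c4 c5 c6.
- by rewrite b6 c7 c8 c9.
Qed.

(** The flag is conjoined with the outcome of each round, so nested loops compute a bounded
    universal quantifier over tuples. *)
Lemma runs_all n v body (s : state K) T (P : nat -> Prop) :
  okfor v rN body -> sized n s ->
  (forall i s1, i < n -> same_off (cfor v rN body) s s1 ->
     sized n s1 -> regs s1 v = i -> regs s1 v.+1 = i * n ->
     regs s1 v.+2 = i * (n * n) ->
     runs body s1 T 0
       (fun s2 => regs s2 rFLAG != 0 <-> regs s1 rFLAG != 0 /\ P i)) ->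
  runs (cfor v rN body) s (Tfor n T) 0 (fun s2 =>
    regs s2 rFLAG != 0 <-> regs s rFLAG != 0 /\ forall i, i < n -> P i).
Proof.
move=> ok sz H; have [h1 h2 h3] := sz.
pose I k (A : nat -> nat -> K) (f : nat) :=
  f != 0 <-> regs s rFLAG != 0 /\ forall i, i < k -> P i.
apply: (runs_for0 (I := I)) => //.
  by split=> [?|[]//]; split=> // i; rewrite ltn0.
move=> i s1 iN so e0 e1 e2 II; rewrite h2 in e1; rewrite h3 in e2.
have sz1 := sized_for ok sz so.
apply: (runs_imp (H i s1 iN so sz1 e0 e1 e2)) => s2 _ E.
split=> [/E[/II[h Pk] Pi]|[h Pk]].
  by split=> // k; rewrite ltnS leq_eqVlt => /orP[/eqP->//|/Pk].
apply/E; split; last exact: Pk.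
by apply/II; split=> // k ki; apply: Pk; apply: ltnW.
Qed.

Definition assoc_sum : cmd :=
  cfor 22 rN (CSetF 2 (IConst 0) (FAdd (FGet 2 (IConst 0))
    (FSub (FMul (FGet 1 (cube_index 13 16 22)) (FGet 1 (cube_index 10 22 19)))
          (FMul (FGet 1 (cube_index 10 16 22))
                (FGet 1 (cube_index 13 22 19)))))).

Definition assoc_check : cmd :=
  cfor 10 rN (cfor 13 rN (cfor 16 rN (cfor 19 rN
    (CSeq (CSetF 2 (IConst 0) FZero) (CSeq assoc_sum
      (CIf (TFieldEq (FGet 2 (IConst 0)) FZero) CSkip
        (CSetI rFLAG (IConst 0)))))))).

(** With structure constants [A], this is the vanishing of coordinate [l] of
    [e_i (e_j e_k) - e_j (e_i e_k)]. For a commutative product this left-commutation amounts to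
    associativity. *)
Definition assoc_eq (n : nat) (A : nat -> K) (i j k l : nat) : Prop :=
  (\sum_(m < n) (A (cell3 n j k m) * A (cell3 n i m l)
     - A (cell3 n i k m) * A (cell3 n j m l)) = 0)%R.

Definition Tassoc (n : nat) : nat :=
  Tfor n (Tfor n (Tfor n (Tfor n (30 + Tfor n 60)))).

Lemma assoc_check_runs n (s : state K) :
  sized n s ->
  runs assoc_check s (Tassoc n) 0 (fun s' => regs s' rFLAG != 0 <->
    regs s rFLAG != 0 /\ forall i, i < n -> forall j, j < n ->
    forall k, k < n -> forall l, l < n -> assoc_eq n (arrays s 1) i j k l).
Proof.
move=> sz.
apply: (runs_all _ sz) => // i s1 iN so1 sz1 i0 i1 i2.
apply: (runs_all _ sz1) => // j s2 jN so2 sz2 j0 j1 j2.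
apply: (runs_all _ sz2) => // k s3 kN so3 sz3 k0 k1 k2.
apply: (runs_all _ sz3) => // l s4 lN so4 sz4 l0 l1 l2.
apply: (runs_cost (T := 3 + (Tfor n 60 + (1 + 4 + (0 + 2)))) (q := 0)) => //;
  last by lia.
apply: (runs_seq (q1 := 0) (q2 := 0)); apply: runs_setF.
apply: (runs_seq (q1 := 0) (q2 := 0)).
pose I m (A : nat -> nat -> K) (f : nat) := (A 2 0 =
  \sum_(0 <= m' < m) (arrays s 1 (cell3 n j k m') * arrays s 1 (cell3 n i m' l)
     - arrays s 1 (cell3 n i k m') * arrays s 1 (cell3 n j m' l)))%R.
have [sz4n sz4s sz42] := sz4.
apply: (runs_for0 (I := I)) => //; first by rewrite /I big_nil.
- move=> m s5 mN so5 e0 e1 e2 II; rewrite /= sz4s in e1; rewrite /= sz42 in e2.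
  apply: (runs_cost (runs_setF _ _)) => //.
  rewrite /I /= /upd !eqxx big_nat_recr //= -II.
  have -> : arrays s5 1 = arrays s 1.
    by rewrite so5.2 //= /upd /= so4.2 // so3.2 // so2.2 // so1.2.
  rewrite e0 e1 (_ : regs s5 15 = j * (n * n)); last by rewrite so5.1 //= so4.1 //
      so3.1.
  rewrite (_ : regs s5 17 = k * n); last by rewrite so5.1 //= so4.1.
  rewrite (_ : regs s5 12 = i * (n * n)); last by rewrite so5.1 //= so4.1 // so3.1
      // so2.1.
  by rewrite (_ : regs s5 19 = l); last by rewrite so5.1.
- move=> s5 so5 _ II.
  apply: (runs_if (q1 := 0) (q2 := 0)) => /=; rewrite II big_mkord => E.
    by apply: runs_skip; rewrite so5.1 //=; split=> [?|[]//]; split=> //; exact/eqP.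
  apply: runs_setI => /=; split=> // -[_ E']; move: E.
  by rewrite -[X in X == 0%R]/(_ : K) E' eqxx.
Qed.

(** * Products and powers by repeated squaring *)

Definition mulv (x y : nat) : cmd :=
  cfor 13 rN (CSeq (CSetF 12 (IReg 13) FZero)
    (cfor 16 rN (cfor 19 rN (CSetF 12 (IReg 13) (FAdd (FGet 12 (IReg 13))
      (FMul (FMul (FGet x (IReg 16)) (FGet y (IReg 19)))
        (FGet 1 (cube_index 16 19 13)))))))).

Definition Tmulv (n : nat) : nat := Tfor n (3 + Tfor n (Tfor n 40)).

Lemma mulv_runs x y n (s : state K) : sized n s -> x != 12 -> y != 12 ->
  runs (mulv x y) s (Tmulv n) 0 (fun s' => forall k, k < n -> arrays s' 12 k =
    (\sum_(i < n) \sum_(j < n)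
      arrays s x i * arrays s y j * arrays s 1 (cell3 n i j k))%R).
Proof.
move=> [sn st s2] x12 y12.
pose G (k i j : nat) := (arrays s x i * arrays s y j * arrays s 1 (cell3 n i j k))%R.
pose I k (A : nat -> nat -> K) (f : nat) := forall k', k' < k -> A 12 k' =
  (\sum_(i < n) \sum_(j < n) G k' i j)%R.
apply: (runs_for0 (I := I)) => // k s1 kN so e0 e1 e2 II.
apply: (runs_seq (q1 := 0) (q2 := 0)); apply: runs_setF; rewrite /= e0.
pose I1 i (A : nat -> nat -> K) (f : nat) :=
  (forall k', k' < k -> A 12 k' = (\sum_(i < n) \sum_(j < n) G k' i j)%R) /\
  A 12 k = (\sum_(i' < i) \sum_(j < n) G k i' j)%R.
apply: (runs_for0 (I := I1)) => //=; first by rewrite so.1.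
- split; last by rewrite /upd !eqxx big_ord0.
  by move=> k' lt; rewrite /upd eqxx ltn_eqF // II.
- move=> i s3 iN so3 i0 i1 i2 [II1 II2].
  pose I2 j (A : nat -> nat -> K) (f : nat) :=
  (forall k', k' < k -> A 12 k' = (\sum_(i < n) \sum_(j < n) G k' i j)%R) /\
  A 12 k = (\sum_(i' < i) \sum_(j < n) G k i' j + \sum_(j' < j) G k i j')%R.
  apply: (runs_for0 (I := I2)) => //=; first by rewrite so3.1 //= so.1.
  + by split=> //; rewrite big_ord0 addr0.
  + move=> j s4 jN so4 j0 j1 j2 [II3 II4].
    have k4 : regs s4 13 = k by rewrite so4.1 // so3.1.
    have ar a : a != 12 -> arrays s4 a = arrays s a.
      move=> na; have nn : a \notin [:: 12] by rewrite inE.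
      have nn2 : a \notin [:: 12; 12] by rewrite !inE negb_or na.
      by rewrite (so4.2 _ nn) (so3.2 _ nn) /= /upd (negbTE na) (so.2 _ nn2).
    have i4 : regs s4 16 = i by rewrite so4.1.
    have i42 : regs s4 18 = i * (n * n) by rewrite so4.1 // i2 /= so.1 ?s2.
    have j4 : regs s4 20 = j * n by rewrite j1 so3.1 //= so.1 ?st.
    apply: (runs_cost (runs_setF _ _)) => //; split=> [k' lt|] /=.
      by rewrite /upd eqxx k4 ltn_eqF // II3.
    rewrite k4 i4 i42 j0 j4 /upd !eqxx II4 !ar // big_ord_recr /= addrA //.
  + by move=> s4 so4 _ [II3 II4]; split=> //; rewrite II4 big_ord_recr.
- move=> s3 so3 _ [II1 II2] k'; rewrite ltnS leq_eqVlt => /orP[/eqP->|]//.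
  exact: II1.
Qed.

Definition copy (dst : nat) : cmd :=
  cfor 13 rN (CSetF dst (IReg 13) (FGet 12 (IReg 13))).

Lemma copy_runs dst n (s : state K) : sized n s -> dst != 12 ->
  runs (copy dst) s (Tfor n 20) 0 (fun s' => forall k, k < n ->
    arrays s' dst k = arrays s 12 k).
Proof.
move=> [sn st s2] d12.
pose I k (A : nat -> nat -> K) (f : nat) := forall k', k' < k ->
  A dst k' = arrays s 12 k'.
apply: (runs_for0 (I := I)) => // k s1 kN so e0 e1 e2 II.
apply: (runs_cost (runs_setF _ _)) => // k'; rewrite ltnS /= /upd e0 eqxx.
have -> : arrays s1 12 = arrays s 12 by rewrite so.2 //= inE eq_sym.
by rewrite leq_eqVlt; case: eqP => [->|_ /=]//; apply: II.
Qed.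

(** The registers offer only halving, so the parity of [q] is computed as [q] minus twice its half.
    Array 10 accumulates the result, array 11 holds the running square and array 12 receives each
    product. *)
Definition pow_step : cmd :=
  CSeq (CIf (TEq (ISub (IReg rQ) (IAdd (IHalf (IReg rQ)) (IHalf (IReg rQ))))
                 (IConst 1))
            (CSeq (mulv 10 11) (copy 10)) CSkip)
    (CSeq (mulv 11 11) (CSeq (copy 11) (CSetI rQ (IHalf (IReg rQ))))).

Definition pow_loop : cmd := CWhile (TLt (IConst 0) (IReg rQ)) pow_step.

Definition Tpow_step (n : nat) : nat :=
  20 + (Tmulv n + Tfor n 20) + (Tmulv n + Tfor n 20).

Definition Tpow (n m : nat) : nat := m * (Tpow_step n + 10) + 10.

Variables (R : comNzRingType) (vec : (nat -> K) -> R) (n : nat) (A : nat -> K).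
Hypothesis vec_eq : forall a b, (forall k, k < n -> a k = b k) -> vec a = vec b.
Hypothesis vec_mul : forall a b c : nat -> K, (forall k, k < n -> c k =
  (\sum_(i < n) \sum_(j < n) a i * b j * A (cell3 n i j k))%R) ->
  vec c = (vec a * vec b)%R.
Hypothesis vec_one : vec (fun k => (k == 0)%:R)%R = 1%R.

(** The product of array 10 with the power [q] of array 11 is preserved while [q] is halved. The
    ring is abstract because it exists only once the table in array 1 is known to be associative. *)
Lemma pow_loop_runs m (s : state K) : sized n s -> arrays s 1 = A ->
  regs s rQ < 2 ^ m ->
  runs pow_loop s (Tpow n m) 0 (fun s' =>
    vec (arrays s' 10) = vec (arrays s 10) * vec (arrays s 11) ^+ regs s rQ)%R.
Proof.
elim: m s => [|m IH] s sz sA.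
  rewrite expn0 ltnS leqn0 => /eqP q0.
  apply: (runs_cost (T := 4) (q := 0)) => //.
  by apply: runs_while_end; rewrite /= q0 // expr0 mulr1.
move=> qm; have [q0|q0] := posnP (regs s rQ).
  apply: (runs_cost (T := 4) (q := 0)) => //.
  by apply: runs_while_end; rewrite /= q0 // expr0 mulr1.
apply: (runs_cost (T := 4 + (Tpow_step n + Tpow n m)) (q := 0)) => //; last first.
  by rewrite /Tpow mulSn; lia.
apply: (runs_while_step (q1 := 0) (q2 := 0)) => //.
apply: (runs_cost (T := (1 + 9 + ((Tmulv n + Tfor n 20) + 0)) + (Tmulv n + (Tfor n
    20 + 3))) (q := 0)) => //;
  last by rewrite /Tpow_step; lia.
apply: (runs_seq (q1 := 0) (q2 := 0)).
set q := regs s rQ in q0 qm *.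
have sub : q - (q./2 + q./2) = odd q by rewrite -{1}(odd_double_half q) -addnn addnK.
apply: (runs_imp (P := fun s1 => [/\ sized n s1, arrays s1 1 = A,
   arrays s1 11 = arrays s 11, regs s1 rQ = q &
   vec (arrays s1 10) = vec (arrays s 10) * vec (arrays s 11) ^+ odd q]%R)).
  apply: (runs_if (T1 := Tmulv n + Tfor n 20) (T2 := 0) (q1 := 0) (q2 := 0)) => /=;
    rewrite -/q sub; case: (odd q) => // _; last first.
    by apply: runs_skip; split=> //; rewrite expr0 mulr1.
  apply: (runs_seq (q1 := 0) (q2 := 0)).
  apply: (runs_imp (mulv_runs sz _ _)) => // s1 so1 E1.
  have sz1 : sized n s1 by apply: (sized_same_off sz so1).
  apply: (runs_imp (copy_runs sz1 _)) => // s2 so2 E2; split.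
  - exact: (sized_same_off sz1 so2).
  - by rewrite so2.2 // so1.2.
  - by rewrite so2.2 // so1.2.
  - by rewrite so2.1 // so1.1.
  - rewrite expr1; apply: vec_mul => k kn; rewrite E2 // E1 //.
    by rewrite sA.
move=> s1 _ [sz1 sA1 B1 Q1 R1].
apply: (runs_seq (q1 := 0) (q2 := 0)).
apply: (runs_imp (mulv_runs sz1 _ _)) => // s2 so2 E2.
have sz2 : sized n s2 by apply: (sized_same_off sz1 so2).
apply: (runs_seq (q1 := 0) (q2 := 0)).
apply: (runs_imp (copy_runs sz2 _)) => // s3 so3 E3.
have sz3 : sized n s3 by apply: (sized_same_off sz2 so3).
apply: runs_setI => /=.
have Q3 : regs s3 rQ = q by rewrite so3.1 // so2.1.
rewrite Q3.
apply: (runs_imp (IH _ _ _ _)) => //=.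
- by rewrite so3.2 // so2.2.
- by rewrite /upd /= ltn_half_double -mul2n -expnS.
move=> s4 so4 ->; rewrite /upd /=.
have -> : vec (arrays s3 10) = vec (arrays s1 10) by rewrite so3.2 // so2.2.
have -> : vec (arrays s3 11) = (vec (arrays s 11) * vec (arrays s 11))%R.
  by apply: vec_mul => k kn; rewrite E3 // E2 // sA1 B1.
by rewrite R1 -mulrA -expr2 -exprM -exprD mul2n odd_double_half.
Qed.

(** The accumulator starts at the coordinates of [e_0], which is the unit of the multiplication in
    array 1. *)
Definition frobenius : cmd :=
  cfor 10 rN
    (CSeq (cfor 13 rN (CSeq (CSetF 10 (IReg 13) FZero)
                            (CSetF 11 (IReg 13) FZero)))
    (CSeq (CSetF 10 (IConst 0) FOne)
    (CSeq (CSetF 11 (IReg 10) FOne)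
    (CSeq (CSetI rQ (IReg 1))
    (CSeq pow_loop
      (cfor 13 rN (CSetF 9 (IAdd (IReg 11) (IReg 13)) (FGet 10 (IReg 13))))))))).

Definition Tfrobenius (m : nat) : nat :=
  Tfor n (30 + (Tfor n 20 + Tpow n m + Tfor n 20)).

Lemma frobenius_runs m p (s : state K) : sized n s -> arrays s 1 = A ->
  regs s 1 = p -> p < 2 ^ m ->
  runs frobenius s (Tfrobenius m) 0 (fun s' => forall i, i < n ->
    vec (fun k => arrays s' 9 (i * n + k)) =
      (vec (fun k => (k == i)%:R) ^+ p)%R).
Proof.
move=> sz sA sp pm.
have [sn st s2] := sz.
pose I i0 (B : nat -> nat -> K) (f : nat) := forall i, i < i0 ->
    vec (fun k => B 9 (i * n + k)) = (vec (fun k => (k == i)%:R) ^+ p)%R.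
apply: (runs_for0 (I := I)) => // i s1 iN so e0 e1 e2 II.
have sz1 : sized n s1 by apply: (sized_same_off sz so).
rewrite st in e1.
apply: (runs_cost (T := Tfor n 20 + (3 + (3 + (2 + (Tpow n m + Tfor n 20))))) (q :=
    0)) => //; last by lia.
apply: (runs_seq (q1 := 0) (q2 := 0)).
pose I1 k (B : nat -> nat -> K) (f : nat) := forall k', k' < k -> (B 10 k' = 0 /\ B
    11 k' = 0)%R.
have [sn1 _ _] := sz1.
apply: (runs_for0 (I := I1)) => //.
  move=> k s3 kN so3 k0 k1 k2 I3.
  apply: (runs_cost (T := 3 + 3) (q := 0)) => //.
  apply: (runs_seq (q1 := 0) (q2 := 0)); apply: runs_setF; apply: runs_setF.
  move=> k'; rewrite ltnS /= /upd /= k0 leq_eqVlt; case: eqP => //= _; exact: I3.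
move=> s3 so3 _ I3.
have sz3 : sized n s3 by apply: (sized_same_off sz1 so3).
apply: (runs_seq (q1 := 0) (q2 := 0)); apply: runs_setF.
apply: (runs_seq (q1 := 0) (q2 := 0)); apply: runs_setF.
apply: (runs_seq (q1 := 0) (q2 := 0)); apply: runs_setI.
apply: (runs_seq (q1 := 0) (q2 := 0)) => /=.
have r1 : regs s3 1 = p by rewrite so3.1 // so.1.
have r10 : regs s3 10 = i by rewrite so3.1.
have r11 : regs s3 11 = i * n by rewrite so3.1.
apply: (runs_imp (pow_loop_runs (m := m) _ _ _)) => /=.
- by [].
- by rewrite /upd /= so3.2 // so.2.
- by rewrite /upd /= r1.
rewrite /upd /= r1 r10 => s4 so4.
rewrite (vec_eq (a := fun j => if j == 0 then _ else _) (b := fun k => (k ==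
    0)%:R)%R); last first.
  by move=> k kn; case: eqP => // _; case: (I3 k kn).
rewrite (vec_eq (a := fun j => if j == i then _ else _) (b := fun k => (k ==
    i)%:R)%R); last first.
  by move=> k kn; case: eqP => // _; case: (I3 k kn).
rewrite vec_one mul1r => E4.
have sz4 : sized n s4 by have [q1 q2 q3] := sz3; split; rewrite so4.1.
have [sn4 _ _] := sz4.
have q11 : regs s4 11 = i * n by rewrite so4.1.
pose I4 k (B : nat -> nat -> K) (f : nat) :=
  (forall i', i' < i -> forall k', k' < n -> B 9 (i' * n + k') = arrays s1 9 (i' *
      n + k')) /\
  (forall k', k' < k -> B 9 (i * n + k') = arrays s4 10 k').
apply: (runs_for0 (I := I4)) => //.
- by split=> // i1 _ k1 _; rewrite so4.2 //= /upd /= so3.2.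
- move=> k s5 kN so5 k0 k1 k2 [I5 I6].
  apply: (runs_cost (runs_setF _ _)) => //.
  have h11 : regs s5 11 = i * n by rewrite so5.1.
  split=> [i' i'i k' k'n|k' k'k] /=; rewrite /upd eqxx h11 k0 cell_inj //.
  + by rewrite [i' == i]ltn_eqF ?I5.
  + by rewrite eqxx /=; case: eqP => [->|kk]; [rewrite so5.2|apply: I6; lia].
  + lia.
- move=> s5 so5 _ [I5 I6] i'; rewrite ltnS leq_eqVlt => /orP[/eqP->|i'i].
    by rewrite -E4; apply: vec_eq => k kn; rewrite I6.
  by rewrite -II //; apply: vec_eq => k kn; rewrite I5.
Qed.

End Loops.

(** * Reading the multiplication table *)

Local Open Scope nat_scope.

(** The empty loop computes [n * n] without a product: after [n] rounds with stride [n], register 11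
    holds it. *)
Definition setup : cmd :=
  CSeq (CSetI rN (IReg 0)) (CSeq (CSetI rSTR (IReg 0))
    (CSeq (cfor 10 rN CSkip) (CSeq (CSetI rN2 (IReg 11))
      (CSeq (CSetI rW (IReg 11)) (CSetI rFLAG (IConst 1)))))).

Definition store (e : fexp) : cmd :=
  cfor 16 rN (CSetF 1 (cube_index 10 13 16) e).

Definition polarize : cmd :=
  CSeq (cfor 16 rN (CSeq (CSetF 3 (IReg 16) FZero) (CSetF 4 (IReg 16) FZero)))
  (CSeq (CSetF 3 (IReg 10) FOne)
  (CSeq (CSetF 4 (IReg 13) FOne)
  (CSeq (cfor 16 rN
    (CSetF 5 (IReg 16) (FAdd (FGet 3 (IReg 16)) (FGet 4 (IReg 16)))))
  (CSeq (CQuery 6 3) (CSeq (CQuery 7 4) (CSeq (CQuery 8 5)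
    (store (FSub (FSub (FGet 8 (IReg 16)) (FGet 7 (IReg 16)))
                 (FGet 6 (IReg 16)))))))))).

Definition multiply : cmd :=
  CSeq (cfor 16 rN (CSeq (CSetF 3 (IReg 16) FZero)
                         (CSetF 3 (IAdd (IReg rN) (IReg 16)) FZero)))
  (CSeq (CSetF 3 (IReg 10) FOne)
  (CSeq (CSetF 3 (IAdd (IReg rN) (IReg 13)) FOne)
  (CSeq (CQuery 6 3) (store (FGet 6 (IReg 16)))))).

Definition fill (body : cmd) : cmd := cfor 10 rN (cfor 13 rN body).

(** With stride [n + 1], row [k + 1] of column [c] is cell [c * n + c + (1 + k)]; the stride
    register still holds [n] at this stage. *)
Definition column_index : iexp :=
  IAdd (IAdd (IReg 11) (IReg 10)) (IAdd (IConst 1) (IReg 13)).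

(* Column [c] of the matrix is [delta_(c,0)] followed by column [c] of
   [phi^2 - phi], where [phi] is the Frobenius matrix of array 9. *)
Definition build : cmd :=
  CSeq (cfor 10 rN
    (CSeq (CSetF 1 (IAdd (IReg 11) (IReg 10)) FZero)
      (cfor 13 rN
        (CSeq (CSetF 1 column_index (FOpp (FGet 9 (IAdd (IReg 11) (IReg 13)))))
          (cfor 16 rN (CSetF 1 column_index (FAdd (FGet 1 column_index)
             (FMul (FGet 9 (IAdd (IReg 11) (IReg 16)))
                   (FGet 9 (IAdd (IReg 17) (IReg 13)))))))))))
  (CSetF 1 (IConst 0) FOne).

(** * Correctness of the set-up, of the table reading and of the Frobenius matrix *)

Section Phases.

Variable K : fieldType.
Variable oracle : (nat -> K) -> seq K.
Notation runs := (runs oracle).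

Lemma setup_runs n (s : state K) : regs s 0 = n ->
  runs setup s (20 + Tfor n 1) 0 (fun s' =>
    [/\ sized n s', regs s' rW = n * n, regs s' rFLAG = 1 & regs s' 1 = regs s 1]).
Proof.
move=> s0.
apply: (runs_cost (T := 2 + (2 + (Tfor n 1 + (2 + (2 + 2))))) (q := 0)) => //;
  last by lia.
apply: (runs_seq (q1 := 0) (q2 := 0)); apply: runs_setI.
apply: (runs_seq (q1 := 0) (q2 := 0)); apply: runs_setI => /=; rewrite s0 /=.
apply: (runs_seq (q1 := 0) (q2 := 0)).
apply: (runs_for0 (I := fun _ _ _ => True)) => //=.
  by move=> i s1 *; apply: (runs_cost (T := 0) (q := 0)) => //; apply: runs_skip.
move=> s1 so e1 _; rewrite /upd /= ?s0 in e1.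
apply: (runs_seq (q1 := 0) (q2 := 0)); apply: runs_setI.
apply: (runs_seq (q1 := 0) (q2 := 0)); apply: runs_setI.
apply: runs_setI; rewrite /= /upd /= e1; split=> //.
  by split; rewrite /= /upd /= ?e1 // so.1 // /upd /= ?s0.
by rewrite so.1.
Qed.

Lemma store_runs n e (s : state K) i j (v : nat -> K) :
  sized n s -> regs s 12 = i * (n * n) -> regs s 14 = j * n -> j < n ->
  (forall k s1, k < n -> same_off (store e) s s1 -> regs s1 16 = k ->
     feval s1 e = v k) -> ops (fcost e) <= 10 ->
  runs (store e) s (Tfor n 20) 0 (fun s' =>
    (forall k, k < n -> arrays s' 1 (cell3 n i j k) = v k) /\
    (forall i' j' k, j' < n -> k < n -> (i', j') != (i, j) ->
      arrays s' 1 (cell3 n i' j' k) = arrays s 1 (cell3 n i' j' k))).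
Proof.
move=> [sn st s2] r12 r14 jn ev ce.
pose I k0 (A : nat -> nat -> K) (f : nat) :=
    (forall k, k < k0 -> A 1 (cell3 n i j k) = v k) /\
    (forall i' j' k, j' < n -> k < n -> (i', j') != (i, j) ->
      A 1 (cell3 n i' j' k) = arrays s 1 (cell3 n i' j' k)).
apply: (runs_for0 (I := I)) => // k0 s1 kn so e0 e1 e2 [I1 I2].
apply: (runs_cost (runs_setF _ _)) => //=.
  rewrite /I /= /upd !eqxx e0 so.1 // r12 so.1 // r14.
  rewrite -/(cell3 n i j k0) (ev k0) //; split=> [k|i' j' k j'n k'n ij].
    rewrite ltnS leq_eqVlt => kk; rewrite cell3_inj ?eqxx //=; last first.
      by case/orP: kk => [/eqP->|/ltn_trans->].
    by case: eqP kk => [->//|_ /= kk]; apply: I1.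
  rewrite cell3_inj //; case: ifP => [/and3P[/eqP a /eqP b _]|_].
    by rewrite a b eqxx in ij.
  exact: I2.
by apply: (@leq_trans (1 + (5 + 10))) => //; rewrite !leq_add2l.
Qed.

Lemma fill_runs n body (s : state K) T q (v : nat -> nat -> nat -> K) :
  okfor 13 rN body -> okfor 10 rN (cfor 13 rN body) -> sized n s ->
  (forall i j s1, i < n -> j < n -> sized n s1 -> regs s1 10 = i ->
     regs s1 12 = i * (n * n) -> regs s1 13 = j -> regs s1 14 = j * n ->
     runs body s1 T q (fun s' =>
    (forall k, k < n -> arrays s' 1 (cell3 n i j k) = v i j k) /\
    (forall i' j' k, j' < n -> k < n -> (i', j') != (i, j) ->
      arrays s' 1 (cell3 n i' j' k) = arrays s1 1 (cell3 n i' j' k)))) ->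
  runs (fill body) s (Tfor n (Tfor n T)) (n * (n * q)) (fun s' =>
    forall i j k, i < n -> j < n -> k < n ->
      arrays s' 1 (cell3 n i j k) = v i j k).
Proof.
move=> ok1 ok2 sz H; have [sn st s2] := sz.
pose I i0 (A : nat -> nat -> K) (f : nat) :=
    forall i j k, i < i0 -> j < n -> k < n -> A 1 (cell3 n i j k) = v i j k.
apply: (runs_forN (I := I)) => // i s1 iN so i0 i1 i2 I1.
have sz1 := sized_for ok2 sz so.
have [sn1 st1 s21] := sz1.
pose J j0 (A : nat -> nat -> K) (f : nat) :=
    forall i' j k, (i' < i) || (i' == i) && (j < j0) -> j < n -> k < n -> A 1
        (cell3 n i' j k) = v i' j k.
apply: (runs_forN (I := J)) => //.
- by move=> i' j k; rewrite ltn0 andbF orbF => *; apply: I1.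
- move=> j s3 jN so3 j0 j1 j2 J1.
  have [s3n st3 s23] := sized_for ok1 sz1 so3.
  have /andP[/= /and5P[b1 _ b3 _ _] _] := ok2.
  apply: (runs_imp (H i j s3 iN jN _ _ _ _ _)) => //.
  + by rewrite so3.1.
  + by rewrite so3.1 // i2 s2.
  + by rewrite j1 st1.
  move=> s4 so4 [h1 h2] i' j' k c j'n kn.
  have [/eqP[-> ->]|ne] := boolP ((i', j') == (i, j)); first exact: h1.
  rewrite h2 //; apply: J1 => //.
  move: c ne; rewrite ltnS [j' <= j]leq_eqVlt xpair_eqE.
  by case: (i' < i) => //=; case: (i' == i) => //=; case: (j' == j).
- move=> s3 so3 _ J1 i' j k; rewrite ltnS leq_eqVlt orbC => c jn kn.
  by apply: J1 => //; case/orP: c => ->; rewrite ?jn ?orbT.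
Qed.

Definition Tpolarize (n : nat) : nat := 30 + (Tfor n 20 + Tfor n 20 + Tfor n 20).

Lemma polarize_runs n (s : state K) i j :
  (forall a b : nat -> K, (forall k, k < n -> a k = b k) -> oracle a = oracle b) ->
  (forall a, size (oracle a) = n) ->
  i < n -> j < n -> sized n s -> regs s 10 = i ->
  regs s 12 = i * (n * n) -> regs s 13 = j -> regs s 14 = j * n ->
  runs polarize s (Tpolarize n) 3 (fun s' =>
    (forall k, k < n -> arrays s' 1 (cell3 n i j k) =
       (nth 0 (oracle (fun k => (k == i)%:R + (k == j)%:R)) k
         - nth 0 (oracle (fun k => (k == j)%:R)) k
         - nth 0 (oracle (fun k => (k == i)%:R)) k)%R) /\
    (forall i' j' k, j' < n -> k < n -> (i', j') != (i, j) ->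
      arrays s' 1 (cell3 n i' j' k) = arrays s 1 (cell3 n i' j' k))).
Proof.
move=> oext osz iN jN sz r10 r12 r13 r14; have [sn st s2] := sz.
apply: (runs_cost (T := Tfor n 20 + (3 + (3 + (Tfor n 20 + (1 + (1 + (1 + Tfor n
    20)))))))
  (q := 0 + (0 + (0 + (0 + (1 + (1 + (1 + 0)))))))) => //; last first.
  by rewrite /Tpolarize; lia.
apply: runs_seq.
pose I1 k0 (A : nat -> nat -> K) (f : nat) :=
  forall k, k < k0 -> (A 3 k = 0 /\ A 4 k = 0)%R.
apply: (runs_for0 (I := I1)) => //.
  move=> k s1 kN so k0 k1 k2 II.
  apply: (runs_cost (T := 3 + 3) (q := 0)) => //.
  apply: (runs_seq (q1 := 0) (q2 := 0)); apply: runs_setF; apply: runs_setF.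
  move=> k'; rewrite ltnS /= /upd /= k0 leq_eqVlt; case: eqP => //= _; exact: II.
move=> s1 so1 _ II1.
apply: runs_seq; apply: runs_setF.
apply: runs_seq; apply: runs_setF => /=.
have ri : regs s1 10 = i by rewrite so1.1.
have rj : regs s1 13 = j by rewrite so1.1.
set t1 := set_cell _ 4 _ _.
apply: runs_seq.
pose I2 k0 (A : nat -> nat -> K) (f : nat) :=
  forall k, k < k0 -> (A 5 k = (k == i)%:R + (k == j)%:R)%R.
have t3 k : k < n -> arrays t1 3 k = (k == i)%:R%R.
  by move=> kn; rewrite /= /upd /= ri; case: eqP => // _; case: (II1 k kn).
have t4 k : k < n -> arrays t1 4 k = (k == j)%:R%R.
  by move=> kn; rewrite /= /upd /= rj; case: eqP => // _; case: (II1 k kn).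
apply: (runs_for0 (I := I2)) => //=; first by rewrite so1.1.
  move=> k s3 kN so k0 k1 k2 II.
  apply: (runs_cost (runs_setF _ _)) => //= k'; rewrite ltnS /= /upd /= k0 leq_eqVlt.
  case: eqP => [->|_]; last exact: II.
  by rewrite !so.2 // t3 // t4.
move=> s3 so3 _ II2.
apply: runs_seq; apply: runs_query.
apply: runs_seq; apply: runs_query.
apply: runs_seq; apply: runs_query => /=.
have q3 k : k < n -> arrays s3 3 k = (k == i)%:R%R by move=> kn; rewrite so3.2 // t3.
have q4 k : k < n -> arrays s3 4 k = (k == j)%:R%R by move=> kn; rewrite so3.2 // t4.
set t2 := set_block _ 8 _.
have keep r : r \notin [:: 16; 17; 18] -> regs t2 r = regs s r.
  rewrite !inE !negb_or => /and3P[n1 n2 n3].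
  by rewrite /= so3.1 ?so1.1 //= !inE !negb_or n1 n2 n3.
have sz2 : sized n t2 by split; rewrite keep.
pose v k := (nth 0 (oracle (arrays s3 5)) k - nth 0 (oracle (arrays s3 4)) k
  - nth 0 (oracle (arrays s3 3)) k)%R.
apply: (runs_imp (store_runs (i := i) (j := j) (v := v) sz2 _ _ _ _ _)).
- by rewrite keep.
- by rewrite keep.
- by [].
- move=> k s4 kn so4 e4 /=; rewrite e4 !so4.2 //= /t2 /= /upd /=.
  by rewrite !osz !kn.
- by [].
move=> s4 so4 [h1 h2]; split=> [k kn|i' j' k j'n kn ne].
  rewrite h1 // /v (oext (arrays s3 3) _ q3) (oext (arrays s3 4) _ q4).
  by rewrite (oext (arrays s3 5) _ II2).
rewrite h2 //= /upd /= so3.2 //= /upd /= so1.2 //.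
Qed.

Definition Tmultiply (n : nat) : nat := 30 + (Tfor n 20 + Tfor n 20).

Lemma multiply_runs n (s : state K) i j :
  (forall a b : nat -> K, (forall k, k < n + n -> a k = b k) -> oracle a = oracle b) ->
  (forall a, size (oracle a) = n) ->
  i < n -> j < n -> sized n s -> regs s 10 = i ->
  regs s 12 = i * (n * n) -> regs s 13 = j -> regs s 14 = j * n ->
  runs multiply s (Tmultiply n) 1 (fun s' =>
    (forall k, k < n -> arrays s' 1 (cell3 n i j k) =
       nth 0%R (oracle (fun k => ((k == i) || (k == n + j))%:R%R)) k) /\
    (forall i' j' k, j' < n -> k < n -> (i', j') != (i, j) ->
      arrays s' 1 (cell3 n i' j' k) = arrays s 1 (cell3 n i' j' k))).
Proof.
move=> oext osz iN jN sz r10 r12 r13 r14; have [sn st s2] := sz.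
apply: (runs_cost (T := Tfor n 20 + (3 + (5 + (1 + Tfor n 20))))
  (q := 0 + (0 + (0 + (1 + 0))))) => //; last first.
  by rewrite /Tmultiply; lia.
apply: runs_seq.
pose I1 k0 (A : nat -> nat -> K) (f : nat) :=
  forall k, k < k0 -> (A 3 k = 0 /\ A 3 (n + k)%N = 0)%R.
apply: (runs_for0 (I := I1)) => //.
  move=> k s1 kN so k0 k1 k2 II.
  apply: (runs_cost (T := 3 + 5) (q := 0)) => //.
  apply: (runs_seq (q1 := 0) (q2 := 0)); apply: runs_setF; apply: runs_setF.
  have r2 : regs s1 2 = n by rewrite so.1.
  move=> k'; rewrite ltnS /= /upd /= k0 r2 leq_eqVlt eqn_add2l.
  case: eqP => [-> _|_ /= kk]; first by rewrite !if_same.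
  have [h1 h2] := II _ kk; rewrite h1 h2; split; repeat case: eqP => //.
move=> s1 so1 _ II1.
apply: runs_seq; apply: runs_setF.
apply: runs_seq; apply: runs_setF => /=.
have ri : regs s1 10 = i by rewrite so1.1.
have rj : regs s1 13 = j by rewrite so1.1.
have rn : regs s1 2 = n by rewrite so1.1.
apply: runs_seq; apply: runs_query => /=.
set a3 := upd _ _ _ _.
have q3 k : k < n + n -> a3 k = ((k == i) || (k == n + j))%:R%R.
  move=> kn; rewrite /a3 /upd /= ri rj rn orbC; case: eqP => // _; case: eqP => //= _.
  have [kn'|nk] := ltnP k n; first by case: (II1 k kn').
  have kn' : k - n < n by rewrite ltn_subLR.
  by case: (II1 _ kn'); rewrite subnKC.
set t2 := set_block _ 6 _.
have keep r : r \notin [:: 16; 17; 18] -> regs t2 r = regs s r.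
  rewrite !inE !negb_or => /and3P[n1 n2 n3].
  by rewrite /= so1.1 //= !inE !negb_or n1 n2 n3.
have sz2 : sized n t2 by split; rewrite keep.
pose v k := nth 0%R (oracle a3) k.
apply: (runs_imp (store_runs (i := i) (j := j) (v := v) sz2 _ _ _ _ _)).
- by rewrite keep.
- by rewrite keep.
- by [].
- move=> k s4 kn so4 e4 /=; rewrite e4 !so4.2 //= /t2 /= /upd /=.
  by rewrite !osz !kn.
- by [].
move=> s4 so4 [h1 h2]; split=> [k kn|i' j' k j'n kn ne].
  by rewrite h1 // /v (oext a3 _ q3).
rewrite h2 //= /upd /= so1.2 //.
Qed.

Definition Tbuild (n : nat) : nat := Tfor n (10 + Tfor n (20 + Tfor n 40)) + 10.

Lemma build_runs n (s : state K) : 0 < n -> sized n s ->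
  runs build s (Tbuild n) 0 (fun s' => forall c, c < n ->
    arrays s' 1 (c * n.+1) = (c == 0)%:R%R /\
    forall k, k < n -> arrays s' 1 (c * n.+1 + k.+1) =
      (\sum_(m < n) arrays s 9 (c * n + m) * arrays s 9 (m * n + k)
         - arrays s 9 (c * n + k))%R).
Proof.
move=> n0 sz; have [sn st s2] := sz.
pose P c k m := (\sum_(m' < m) arrays s 9 (c * n + m') * arrays s 9 (m' * n + k)
         - arrays s 9 (c * n + k))%R.
(* Row 0 is filled with zeros in the loop; its only 1, in column 0, is written by the last
   assignment. *)
pose G c r : K := if r is k.+1 then P c k n else 0%R.
apply: (runs_cost (T := Tfor n (10 + Tfor n (20 + Tfor n 40)) + 3) (q := 0)) => //;
    last first.
  by rewrite /Tbuild; lia.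
apply: (runs_seq (q1 := 0) (q2 := 0)).
pose I c0 (A : nat -> nat -> K) (f : nat) :=
  forall c r, c < c0 -> r < n.+1 -> A 1 (c * n.+1 + r) = G c r.
have E c k : c * n + c + (1 + k) = c * n.+1 + k.+1 by rewrite mulnS; lia.
apply: (runs_for0 (I := I)) => //; last first.
  move=> s1 so _ II; apply: runs_setF => c cn; rewrite /= /upd /=; split.
    have [->|c0] := posnP c; first by rewrite mul0n.
    by rewrite muln_eq0 gtn_eqF //= -[c * n.+1]addn0 II.
  by move=> k kn; rewrite addnS /= -addnS II.
move=> c s1 cN so c0 c1 c2 II.
have sz1 : sized n s1 by apply: (sized_same_off sz so).
have [sn1 _ _] := sz1; rewrite st in c1.
apply: (runs_cost (T := 5 + Tfor n (20 + Tfor n 40)) (q := 0)) => //; last by lia.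
apply: (runs_seq (q1 := 0) (q2 := 0)); apply: runs_setF => /=; rewrite c0 c1.
pose J k0 (A : nat -> nat -> K) (f : nat) :=
  forall c' r, (c' < c) || (c' == c) && (r <= k0) -> r < n.+1 ->
    A 1 (c' * n.+1 + r) = G c' r.
have E0 : c * n + c = c * n.+1 + 0 by rewrite mulnS; lia.
apply: (runs_for0 (I := J)) => //.
- move=> c' r cr rn; rewrite /= /upd /= E0 cell_inj //.
  have [cc|ne] /= := eqVneq c' c; last first.
    by apply: II => //; move: cr; rewrite (negbTE ne) orbF.
    by move: cr; rewrite cc ltnn eqxx /= leqn0 => /eqP->.
- move=> k s3 kN so3 k0 k1 k2 JJ /=.
  have h10 : regs s3 10 = c by rewrite so3.1.
  have h11 : regs s3 11 = c * n by rewrite so3.1.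
  have h2 : regs s3 rN = n by rewrite so3.1.
  have h4 : regs s3 rSTR = n by rewrite so3.1 //= so.1.
  have h9 : arrays s3 9 = arrays s 9 by rewrite so3.2 //= /upd /= so.2.
  apply: (runs_cost (T := 13 + Tfor n 40) (q := 0)) => //; last by lia.
  apply: (runs_seq (q1 := 0) (q2 := 0)).
  apply: (runs_cost (runs_setF _ _)) => //=.
  rewrite h10 h11 k0 E h9.
  pose L m0 (A : nat -> nat -> K) (f : nat) :=
    (forall c' r, (c' < c) || (c' == c) && (r <= k) -> r < n.+1 ->
      A 1 (c' * n.+1 + r) = G c' r) /\ A 1 (c * n.+1 + k.+1) = P c k m0.
  apply: (runs_for0 (I := L)) => //=.
  + split; last by rewrite /upd !eqxx /P big_ord0 add0r.
    move=> c' r cr rn; rewrite /upd /= cell_inj //.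
    have [cc|ne] /= := eqVneq c' c; last exact: JJ.
    rewrite ltn_eqF; first exact: JJ.
    by move: cr; rewrite cc ltnn eqxx.
  + move=> m s4 mN so4 m0 m1 m2 [L1 L2].
    have g10 : regs s4 10 = c by rewrite so4.1.
    have g13 : regs s4 13 = k by rewrite so4.1.
    have g11 : regs s4 11 = c * n by rewrite so4.1.
    have g9 : arrays s4 9 = arrays s 9 by rewrite so4.2 //= /upd /=.
    rewrite /= h4 in m1.
    apply: (runs_cost (runs_setF _ _)) => //=.
    rewrite /L /= g10 g13 g11 g9 m0 m1 E /upd /= eqxx L2; split.
      move=> c' r cr rn; rewrite cell_inj //.
      have [cc|ne] /= := eqVneq c' c; last exact: L1.
      rewrite ltn_eqF; first exact: L1.
      by move: cr; rewrite cc ltnn eqxx.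
    by rewrite /P big_ord_recr /= addrAC.
  + move=> s4 so4 _ [L1 L2] c' r cr rn.
    have [/andP[/eqP-> /eqP->]|ne] := boolP ((c' == c) && (r == k.+1)).
      by rewrite L2.
    apply: L1 => //; move: cr ne; rewrite [r <= k.+1]leq_eqVlt ltnS.
    by case: (c' < c) => //=; case: (c' == c) => //=; case: (r == k.+1).
- move=> s3 so3 _ JJ c' r; rewrite ltnS leq_eqVlt orbC => cr rn.
  by apply: JJ => //; move: (rn); rewrite ltnS => ->; rewrite andbT.
Qed.

End Phases.

(** * Commutative algebras on the space of F *)

Local Open Scope ring_scope.

Record fp_alg (p : nat) (F : fieldExtType 'F_p) : Type := FpAlg {
  amul : F -> F -> F;
  aone : F;
  amulA : associative amul;
  amulC : commutative amul;
  amul1 : left_id aone amul;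
  amulDl : left_distributive amul +%R;
  amulZl : forall (a : 'F_p) x y, amul (a *: x) y = a *: amul x y;
  aone_neq0 : aone != 0 }.

(** A separate name for the finite space underlying [F]: it can carry a second ring structure that
    does not clash with the multiplication of [F]. The argument [m] serves only to index the
    instances. *)
Definition alg_ring (p : nat) (F : fieldExtType 'F_p) (m : fp_alg F) : Type :=
  finvect_type F.

Section AlgRing.

Variables (p : nat) (F : fieldExtType 'F_p) (m : fp_alg F).
Local Notation A := (alg_ring m).

HB.instance Definition _ := Vector.on A.
HB.instance Definition _ := Finite.copy A (finvect_type F).
HB.instance Definition _ := GRing.Zmodule_isComNzRing.Build A
  (@amulA _ _ m) (@amulC _ _ m) (@amul1 _ _ m) (@amulDl _ _ m) (aone_neq0 m).
HB.instance Definition _ := GRing.Lmodule_isLalgebra.Build 'F_p A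
  (fun a u v => esym (amulZl m a u v)).
HB.instance Definition _ := GRing.Lalgebra_isComAlgebra.Build 'F_p A.

End AlgRing.

(** * A Frobenius criterion for finite commutative algebras to be fields *)

Section Frobenius.

Variables (p : nat) (F : fieldExtType 'F_p) (m : fp_alg F).
Hypothesis prime_p : prime p.
Local Notation A := (alg_ring m).

Lemma pchar_alg_ring : p \in [pchar A].
Proof.
rewrite inE prime_p /= -scaler_nat (_ : p%:R = 0 :> 'F_p) ?scale0r //.
by case/andP: (pchar_Fp prime_p) => _ /eqP.
Qed.

Lemma Fp_expp (a : 'F_p) : a ^+ p = a.
Proof. by rewrite -{2}(expf_card a) card_Fp. Qed.

Lemma alg_exppB (x y : A) : (x - y) ^+ p = x ^+ p - y ^+ p.
Proof. exact: (pFrobenius_autB_comm pchar_alg_ring (mulrC x y)). Qed.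

Lemma alg_exppZ (a : 'F_p) (x : A) : (a *: x) ^+ p = a *: x ^+ p.
Proof. by rewrite exprZn Fp_expp. Qed.

(* The hypothesis says both that Frobenius is injective (no nilpotents) and
   that its fixed space, of one dimension per field factor, is a line. *)
Lemma alg_ring_field :
  (forall x : A, x ^+ p ^+ p = x ^+ p -> exists a : 'F_p, x = a *: 1) ->
  forall x : A, x != 0 -> exists y : A, y * x = 1.
Proof.
move=> fixP x x0.
have p0 : (0 < p)%N := prime_gt0 prime_p.
pose phi (y : A) := y ^+ p.
(* If [(y - z) ^+ p] is zero, the hypothesis holds trivially for [y - z], which is then a scalar;
   Frobenius fixes scalars, so it is zero. *)
have phi_inj : injective phi.
  move=> y z /eqP; rewrite -subr_eq0 -alg_exppB => /eqP yz.
  have [a Ea] : exists a : 'F_p, y - z = a *: 1.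
    by apply: fixP; rewrite yz expr0n gtn_eqF.
  move: yz; rewrite Ea alg_exppZ expr1n => /eqP.
  by rewrite -Ea subr_eq0 => /eqP.
have iterE k y : iter k phi y = y ^+ (p ^ k).
  by elim: k => [|k IH]; rewrite ?expr1 //= IH /phi -exprM expnSr.
have := iter_order phi_inj x; rewrite iterE.
set N := fingraph.order phi x; set q := (p ^ N)%N => xq.
have q2 : (1 < q)%N by rewrite -[1%N](expn0 p) ltn_exp2l ?prime_gt1 //; exact:
    fingraph.order_gt0.
(* Since [phi] is injective on a finite set, [x ^+ q = x] for a positive power [q] of [p]. So [e] is
   an idempotent with [e * x = x]; it is fixed by Frobenius, hence scalar, hence 1, and [x ^+ q.-2]
   inverts [x]. *)
pose e := x ^+ q.-1.
have ex : e * x = x by rewrite -exprSr prednK // ltnW.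
have ee : e * e = e.
  rewrite {1}/e -(prednK (_ : 0 < q.-1)%N); last by rewrite -subn1 subn_gt0.
  rewrite exprSr -mulrA [x * e]mulrC ex -exprSr prednK //; last by rewrite -subn1
      subn_gt0.
have ek k : e ^+ k.+1 = e by elim: k => [|k IH]; rewrite ?expr1 // exprS IH.
have ep : e ^+ p = e by have := ek p.-1; rewrite prednK.
have [a Ea] : exists a : 'F_p, e = a *: 1 by apply: fixP; rewrite !ep.
have e1 : e = 1.
  have [a0|a0] := eqVneq a 0.
    by move: x0; rewrite -ex Ea a0 scale0r mul0r eqxx.
  have /eqP := ee; rewrite Ea -scalerAl mul1r scalerA -subr_eq0 -scalerBl.
  rewrite scaler_eq0 oner_eq0 orbF -{3}(mulr1 a) -mulrBr mulf_eq0 (negbTE a0) /=.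
  by rewrite subr_eq0 => /eqP->; rewrite scale1r.
exists (x ^+ q.-2); rewrite -exprSr prednK //.
by rewrite -subn1 subn_gt0.
Qed.

End Frobenius.

Record field_alg (p : nat) (F : fieldExtType 'F_p) : Type := FieldAlg {
  field_alg_base :> fp_alg F;
  field_algV : forall x : alg_ring field_alg_base, x != 0 -> exists y, y * x = 1 }.

Definition alg_field (p : nat) (F : fieldExtType 'F_p) (m : field_alg F) : Type :=
  alg_ring m.

Section AlgField.

Variables (p : nat) (F : fieldExtType 'F_p) (m : field_alg F).
Local Notation K := (alg_field m).

HB.instance Definition _ := GRing.Lalgebra.on K.
HB.instance Definition _ := GRing.ComNzRing.on K.
HB.instance Definition _ := Finite.on K.

Definition alg_inv (x : K) : K := if [pick y : K | y * x == 1] is Some y then y else 0.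

Lemma alg_mulVx (x : K) : x != 0 -> alg_inv x * x = 1.
Proof.
move=> /(@field_algV _ _ m)[y yx]; rewrite /alg_inv.
by case: pickP => [z /eqP|/(_ y)] //; rewrite [_ * _]yx eqxx.
Qed.

Lemma alg_inv0 : alg_inv 0 = 0.
Proof.
rewrite /alg_inv; case: pickP => // y /eqP/esym.
by rewrite mulr0 => /eqP; rewrite oner_eq0.
Qed.

HB.instance Definition _ := GRing.ComNzRing_isField.Build K alg_mulVx alg_inv0.

End AlgField.

(** * Uniqueness of the finite field of a given order *)

Section Isomorphism.

Variables (p : nat) (F : fieldExtType 'F_p) (m : field_alg F).
Hypothesis prime_p : prime p.
Local Notation K := (alg_field m).
Local Notation FF := (finvect_type F).

Local Notation toF := (map_poly (GRing.in_alg F)).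
Local Notation toK := (map_poly (GRing.in_alg K)).

(** The minimal polynomial of [theta] over the prime field divides X^|F| - X, which splits over [K]
    because [K] has as many elements as [F]. Any root of it in [K] is a root of all its
    multiples. *)
Lemma root_transfer (theta : F) :
  exists beta : K,
    forall q : {poly 'F_p}, root (toF q) theta -> root (toK q) beta.
Proof.
have /polyOver1P[h hE] := minPolyOver 1 theta.
have hdvd q : root (toF q) theta -> h %| q.
  move=> rq; rewrite -(dvdp_map (GRing.in_alg F)) -hE.
  by apply: minPoly_dvdp => //; apply/polyOver1P; exists q.
pose P : {poly 'F_p} := 'X^#|FF| - 'X.
have hP : h %| P.
  apply: hdvd; rewrite /root rmorphB /= map_polyXn map_polyX !hornerE.
  by rewrite [theta ^+ _](expf_card (theta : FF)) subrr.
have KF : #|FF| = #|{: K}| by [].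
have PK : toK P = \prod_(x : K) ('X - x%:P).
  by rewrite -finField_genPoly rmorphB /= map_polyXn map_polyX KF.
have : toK h %| toK P by rewrite dvdp_map.
rewrite PK => /dvdp_prod_XsubC[ms].
have sh : (1 < size (toK h))%N.
  rewrite size_map_poly -(size_map_poly (GRing.in_alg F)) -hE size_minPoly.
  by rewrite ltnS adjoin_degreeE divn_gt0 ?adim_gt0 // dimvS // subv_adjoin.
case: (mask ms _) => [|beta s] E.
  by move: sh; rewrite (eqp_size E) big_nil size_poly1.
exists beta => // q /hdvd hq.
have : toK h %| toK q by rewrite dvdp_map.
case/dvdpP=> r ->; rewrite rootM orbC.
by rewrite (eqp_root E) big_cons rootM root_XsubC eqxx.
Qed.

(** A generator [theta] of the cyclic unit group makes every element of [F] a polynomial in [theta];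
    the map replaces [theta] by [beta]. By [root_transfer] the value does not depend on the chosen
    polynomial, and a unit cannot be sent to zero, so the map is injective. *)
Lemma alg_field_iso : exists f : {linear F -> F},
  bijective f /\ forall a b, f (a * b) = amul m (f a) (f b).
Proof.
have /cyclicP[u uE] := field_unit_group_cyclic [set: {unit FF}]%G.
pose theta : F := FinRing.uval u.
have gen (x : F) : exists q : {poly 'F_p}, (toF q).[theta] == x.
  have [->|x0] := eqVneq x 0; first by exists 0; rewrite rmorph0 horner0.
  have ux : (x : FF) \is a GRing.unit by rewrite unitfE.
  have : FinRing.unit FF ux \in [set: {unit FF}]%G by rewrite inE.
  rewrite uE => /cycleP[k Ek]; exists 'X^k.
  rewrite map_polyXn hornerXn; apply/eqP.
  have := congr1 (@FinRing.uval _) Ek; rewrite FinRing.val_unitX /= => ->.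
  by [].
have [beta betaP] := root_transfer theta.
pose q x := xchoose (gen x).
have qE x : (toF (q x)).[theta] = x by apply/eqP/(xchooseP (gen x)).
pose f (x : F) : K := (toK (q x)).[beta].
have fE r x : (toF r).[theta] = x -> f x = (toK r).[beta].
  move=> rx; apply/eqP; rewrite -subr_eq0 /f -hornerN -hornerD -rmorphB.
  by apply: betaP; rewrite /root rmorphB hornerD hornerN qE rx subrr.
have f1 : f 1 = 1 by rewrite (fE 1) rmorph1 hornerC.
have fM x y : f (x * y) = f x * f y.
  by rewrite (fE (q x * q y)) rmorphM hornerM ?qE.
have fD (a : 'F_p) (x y : F) : f (a *: x + y) = a *: f x + f y.
  rewrite (fE (a *: q x + q y)) linearP /=; last first.
    by rewrite hornerD hornerZ !qE mulr_algl.
  by rewrite hornerD hornerZ mulr_algl.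
have lf : linear (f : F -> F) by move=> a x y; exact: fD.
pose fl := GRing.isLinear.Build 'F_p F F _ f lf.
pose g : {linear F -> F} := HB.pack (f : F -> F) fl.
exists g; split; last by move=> a b; exact: fM.
suff inj : injective f by exact: (injF_bij (inj : @injective FF FF f)).
move=> x y fxy; apply/eqP; rewrite -subr_eq0; apply/negP => /negP xy.
have : f (x - y) = 0.
  by have := fD (-1) y x; rewrite scaleN1r addrC fxy scaleN1r addNr.
move=> f0; have := f1; rewrite -(mulVf xy) fM f0 mulr0 => /eqP.
by rewrite eq_sym oner_eq0.
Qed.

End Isomorphism.

(** * Isotopy to the field *)

Local Open Scope ring_scope.

(** The middle term between the two decision problems: one map [A] acts on both factors, as the
    inner polynomial [L] does in an equivalence of [g] with the square. *)
Definition strongly_isotopic (p : nat) (F : fieldExtType 'F_p)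
    (star : F -> F -> F) : Prop :=
  exists A C : {linear F -> F},
    [/\ bijective A, bijective C & forall a b, star (A a) (A b) = C (a * b)].

Section FiniteMaps.

Variables (p : nat) (F : fieldExtType 'F_p).

Lemma inj_bijective (f : F -> F) : injective f -> bijective f.
Proof. by move=> fi; exact: (injF_bij (fi : @injective (finvect_type F)
    (finvect_type F) f)). Qed.

End FiniteMaps.

Section Criterion.

Variables (p : nat) (F : fieldExtType 'F_p) (star : F -> F -> F) (u : F).
Hypothesis prime_p : prime p.
Hypothesis starC : commutative star.
Hypothesis starP : forall x, linear (star x).
Hypothesis u0 : u != 0.

Let starDr x y z : star x (y + z) = star x y + star x z.
Proof. by have := starP x 1 y z; rewrite !scale1r. Qed.

Let starDl x y z : star (x + y) z = star x z + star y z.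
Proof. by rewrite starC starDr ![star z _]starC. Qed.

Let star0 x : star x 0 = 0.
Proof. by apply: (addrI (star x 0)); rewrite -starDr !addr0. Qed.

Let starZr a x y : star x (a *: y) = a *: star x y.
Proof. by have := starP x a y 0; rewrite star0 !addr0. Qed.

Let starZl a x y : star (a *: x) y = a *: star x y.
Proof. by rewrite starC starZr starC. Qed.

Section Quotient.

Variable mul : F -> F -> F.
Hypothesis inj_u : injective (star u).
Hypothesis mulE : forall x y, star x y = star u (mul x y).

Lemma quotC : commutative mul.
Proof. by move=> x y; apply: inj_u; rewrite -!mulE starC. Qed.

Lemma quot1 : left_id u mul.
Proof. by move=> x; apply: inj_u; rewrite -mulE. Qed.

Lemma quotDl : left_distributive mul +%R.
Proof. by move=> x y z; apply: inj_u; rewrite starDr -!mulE starDl. Qed.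

Lemma quotZl (a : 'F_p) x y : mul (a *: x) y = a *: mul x y.
Proof. by apply: inj_u; rewrite starZr -!mulE starZl. Qed.

Hypothesis mul_lcomm : forall x y z, mul x (mul y z) = mul y (mul x z).

Lemma quotA : associative mul.
Proof. by move=> x y z; rewrite [mul y z]quotC mul_lcomm quotC. Qed.

Definition quot_alg : fp_alg F :=
  FpAlg quotA quotC quot1 quotDl quotZl u0.

(** With an isomorphism [f] from the field to the algebra, the witnesses are [A = f] and
    [C = star u \o f]. *)
Lemma quot_strongly_isotopic :
  (forall x : alg_ring quot_alg,
     x ^+ p ^+ p = x ^+ p -> exists a : 'F_p, x = a *: 1) ->
  strongly_isotopic star.
Proof.
move=> /(alg_ring_field prime_p) inv.
have [f [fb fM]] := alg_field_iso (FieldAlg inv).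
pose su := GRing.isLinear.Build 'F_p F F _ (star u) (starP u).
pose g : {linear F -> F} := HB.pack (star u) su.
pose C : {linear F -> F} := g \o f.
exists f, C; split=> //.
  by apply: bij_comp => //; apply: inj_bijective.
by move=> a b; rewrite mulE /C /= fM.
Qed.

End Quotient.

Section Necessary.

Hypothesis iso : isotopic star (fun a b => a * b).

(* Commutativity of star makes the inverses of A and B proportional, so a
   single bijection E remains. *)
Lemma isotopic_quot :
  injective (star u) /\ forall mul, (forall x y, star x y = star u (mul x y)) ->
  exists E : F -> F, [/\ injective E, forall x y, E (mul x y) = E x * E y
    , E u = 1 & linear E].
Proof.
case: iso => A [B [C [[A' AK A'K] [B' BK B'K] bC H]]].
have H' x y : star x y = C (A' x * B' y) by rewrite -H A'K B'K.
have Cinj := bij_inj bC.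
have a0 : A' u != 0.
  by apply: contraNneq u0 => a0; rewrite -(A'K u) a0 raddf0.
have b0 : B' u != 0.
  by apply: contraNneq u0 => b0; rewrite -(B'K u) b0 raddf0.
have inj_u : injective (star u).
  move=> x y; rewrite !H' => /Cinj/(mulfI a0) e.
  by rewrite -(B'K x) e B'K.
split=> // mul mulE.
(* Cancelling [C] leaves an identity between [A'] and [B']. At [y = u], a right unit of [mul] by
   commutativity, it makes [A'] a multiple of [B']; dividing [B'] by its value at [u] then gives the
   multiplicative map. *)
have e1 x y : A' u * B' (mul x y) = A' x * B' y.
  by apply: Cinj; rewrite -!H' -mulE.
have mulu x : mul x u = x.
  by apply: inj_u; rewrite -mulE starC.
have e2 x : A' x = A' u * B' x / B' u.
  by have := e1 x u; rewrite mulu => ->; rewrite mulfK.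
exists (fun x => B' x / B' u); split.
- by move=> x y /(divIf b0) e; rewrite -(B'K x) e B'K.
- move=> x y; apply: (mulfI a0); rewrite mulrA e1 e2; field.
  by [].
- by rewrite divff.
- move=> a x y; rewrite -{1}(B'K x) -{1}(B'K y) -linearP /= BK mulrDl.
  by rewrite scalerAl.
Qed.

Lemma isotopic_lcomm mul : (forall x y, star x y = star u (mul x y)) ->
  forall x y z, mul x (mul y z) = mul y (mul x z).
Proof.
move=> mulE x y z; have [_ /(_ _ mulE)[E [Ei EM _ _]]] := isotopic_quot.
by apply: Ei; rewrite !EM mulrCA.
Qed.

(** The map [E] transports the equation into [F], where Frobenius is injective: the image satisfies
    [y ^+ p = y] and lies in the prime field by Fermat. Linearity and [E u = 1] bring the scalar
    back. *)
Lemma isotopic_fixed (m : fp_alg F) :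
  (forall x y, star x y = star u (amul m x y)) -> aone m = u ->
  forall x : alg_ring m, x ^+ p ^+ p = x ^+ p -> exists a : 'F_p, x = a *: 1.
Proof.
move=> mulE m1 x; have [_ /(_ _ mulE)[E [Ei EM E1 El]]] := isotopic_quot.
have E0 : E 0 = 0.
  by have := El (-1) 0 0; rewrite !scaleN1r oppr0 addr0 addNr.
have EZ (a : 'F_p) y : E (a *: y) = a *: E y.
  by have := El a y 0; rewrite E0 !addr0.
have EX k (y : alg_ring m) : E (y ^+ k) = E y ^+ k.
  elim: k => [|k IH]; first by rewrite !expr0 -E1 -m1.
  by rewrite !exprS -IH -EM.
move/(congr1 E); rewrite !EX => xp.
have pF : p \in [pchar F] by rewrite (fmorph_pchar (GRing.in_alg F)) pchar_Fp.
have : pFrobenius_aut pF (E x ^+ p) = pFrobenius_aut pF (E x) by [].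
move=> /(fmorph_inj (pFrobenius_aut pF)) Ex.
have : (E x : F) \in (1%AS : {subfield F}).
  by rewrite Fermat's_little_theorem dimv1 expn1 card_Fp // Ex.
case/vlineP=> a Ea; exists a; apply: Ei.
by rewrite Ea EZ -[1 in RHS]/(aone m) m1 E1.
Qed.

(** Since [E] turns [mul] into the field product, its inverse serves for both factors, and [C] is
    that inverse followed by [star u]. *)
Lemma isotopic_strongly_isotopic : strongly_isotopic star.
Proof.
have [inj_u H] := isotopic_quot.
have [h hK Kh] := inj_bijective inj_u.
have mulE x y : star x y = star u (h (star x y)) by rewrite Kh.
have [E [Ei EM _ El]] := H _ mulE.
have [A EK AK] := inj_bijective Ei.
have Al : linear A by move=> a x y; apply: Ei; rewrite El !AK.
pose L : {linear F -> F} :=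
  HB.pack (star u) (GRing.isLinear.Build 'F_p F F _ _ (starP u)).
pose A' : {linear F -> F} := HB.pack A (GRing.isLinear.Build 'F_p F F _ _ Al).
pose C : {linear F -> F} := L \o A'.
exists A', C; split.
- by exists E.
- by apply: bij_comp; [exact: inj_bijective|exists E].
- by move=> a b; rewrite mulE /C /=; congr (star u _); apply: Ei; rewrite EM !AK.
Qed.

End Necessary.

Lemma strongly_isotopic_isotopic :
  strongly_isotopic star -> isotopic star (fun a b => a * b).
Proof. by case=> A [C [bA bC H]]; exists A, A, C. Qed.

End Criterion.

(** * Extended-affine equivalence to the square map *)

Local Open Scope ring_scope.

Section Polynomials.

Variables (p n : nat) (F : fieldExtType 'F_p) (e : n.-tuple F).
Hypothesis prime_p : prime p.
Hypothesis n_gt0 : (0 < n)%N.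
Hypothesis basis_e : basis_of {: F} e.

Local Notation FF := (finvect_type F).

Lemma pchar_ext : p \in [pchar F].
Proof. by rewrite (fmorph_pchar (GRing.in_alg F)) pchar_Fp. Qed.

Lemma card_ext : #|FF| = (p ^ n)%N.
Proof.
have -> : #|FF| = #|(fullv : {vspace FF})| by apply: eq_card => x; rewrite memvf.
rewrite card_vspace card_Fp //.
by congr (p ^ _)%N; rewrite (size_basis basis_e).
Qed.

Lemma pn_gt1 : (1 < p ^ n)%N.
Proof. by rewrite -[1%N](expn0 p) ltn_exp2l ?prime_gt1. Qed.

Lemma coord_expand (x : F) : x = \sum_(k < n) coord e k x *: e`_k.
Proof. exact: (coord_basis basis_e (memvf x)). Qed.

Lemma linear_eq_basis (f g : F -> F) : linear f -> linear g ->
  (forall k : 'I_n, f e`_k = g e`_k) -> f =1 g.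
Proof.
move=> lf lg fg x.
pose f' : {linear F -> F} := HB.pack f (GRing.isLinear.Build 'F_p F F _ f lf).
pose g' : {linear F -> F} := HB.pack g (GRing.isLinear.Build 'F_p F F _ g lg).
rewrite (coord_expand x) -[LHS]/(f' _) -[RHS]/(g' _) !linear_sum.
by apply: eq_bigr => k _; rewrite !linearZ /= fg.
Qed.

Lemma expp_linear (i : nat) : linear (fun x : F => x ^+ (p ^ i)).
Proof.
elim: i => [|i IH] a x y; first by rewrite expn0 !expr1.
rewrite expnSr !exprM IH.
rewrite -[LHS]/(pFrobenius_aut pchar_ext _) pFrobenius_autD_comm; last exact: mulrC.
by rewrite !pFrobenius_autE exprZn Fp_expp.
Qed.

Lemma horner_linearized m (u : nat -> F) x :
  (\sum_(i < m) u i *: 'X^(p ^ i)).[x] = \sum_(i < m) u i * x ^+ (p ^ i).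
Proof. by rewrite horner_sum; apply: eq_bigr => i _; rewrite hornerZ hornerXn. Qed.

Lemma linearized_linear (L : {poly F}) : linearized L -> linear (horner L).
Proof.
case=> m [u ->] a x y; rewrite !horner_linearized scaler_sumr -big_split /=.
by apply: eq_bigr => i _; rewrite expp_linear mulrDr scalerAr.
Qed.

Lemma poly_eq0_vanish (P : {poly F}) :
  (size P <= p ^ n)%N -> (forall x, P.[x] = 0) -> P = 0.
Proof.
move=> sP P0; apply/eqP; apply: contraLR sP => nP; rewrite -ltnNge -card_ext cardE.
apply: max_poly_roots => //; last exact: (enum_uniq FF).
by apply/allP => x _; rewrite /root P0.
Qed.

(* Invertibility of the Moore matrix of a basis. *)
Lemma linear_linearized (f : F -> F) : linear f ->
  exists2 L : {poly F}, linearized L & forall x, L.[x] = f x.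
Proof.
move=> lf; pose M : 'M[F]_n := \matrix_(j, i) e`_i ^+ (p ^ j).
have uM : M \in unitmx.
  (* A left kernel vector gives a linearized polynomial of degree below [p ^ n] that vanishes on the
     basis, hence on all of [F]. It is therefore zero, and so are its coefficients. *)
  rewrite unitmxE unitfE; apply/negP => /det0P[v v0 vM].
  pose u (k : nat) : F := if (insub k : option 'I_n) is Some j then v 0 j else 0.
  have uE (j : 'I_n) : u j = v 0 j by rewrite /u valK.
  pose P := \sum_(i < n) u i *: 'X^(p ^ i).
  have lP : linearized P by exists n, u.
  have P0 : P = 0.
    apply: poly_eq0_vanish.
      apply: leq_trans (size_sum _ _ _) _; apply/bigmax_leqP => i _.
      apply: leq_trans (size_scale_leq _ _) _; rewrite size_polyXn.
      by rewrite ltn_exp2l ?prime_gt1.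
    move=> x; apply: (linear_eq_basis (linearized_linear lP) (g := fun=> 0)).
      by move=> a y z; rewrite scaler0 addr0.
    move=> k; transitivity ((v *m M) 0 k); last by rewrite vM mxE.
    rewrite horner_linearized mxE; apply: eq_bigr => i _.
    by rewrite uE ?mxE.
  case/eqP: v0; apply/rowP => j; rewrite mxE -uE.
  have := congr1 (fun Q : {poly F} => Q`_(p ^ j)) P0; rewrite coef0 coef_sum.
  rewrite (bigD1 j) //= big1 ?addr0 => [|i ij]; rewrite coefZ coefXn.
    by rewrite eqxx mulr1.
  by rewrite eqn_exp2l ?prime_gt1 // eq_sym (inj_eq val_inj) (negbTE ij) mulr0.
pose w := (\row_i f e`_i) *m invmx M.
pose u (k : nat) : F := if (insub k : option 'I_n) is Some j then w 0 j else 0.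
have uE (j : 'I_n) : u j = w 0 j by rewrite /u valK.
have lL : linearized (\sum_(i < n) u i *: 'X^(p ^ i)) by exists n, u.
exists (\sum_(i < n) u i *: 'X^(p ^ i)) => //.
apply: linear_eq_basis => //; first exact: linearized_linear.
move=> k; rewrite horner_linearized.
have := congr1 (fun A : 'rV_n => A 0 k) (mulmxKV uM (\row_i f e`_i)).
by rewrite !mxE => <-; apply: eq_bigr => i _; rewrite uE ?mxE.
Qed.

Lemma field_poly_horner (x : F) : ('X^(p ^ n) - 'X : {poly F}).[x] = 0.
Proof.
by rewrite !hornerE -card_ext [x ^+ _](expf_card (x : FF)) subrr.
Qed.

(** The modulus vanishes on [F], and remainders have degree below the number of elements of [F], so
    they are determined by their values. Equivalence of polynomials thus becomes an identity of
    functions. *)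
Lemma modp_field_poly (P Q : {poly F}) :
  P %% ('X^(p ^ n) - 'X) = Q %% ('X^(p ^ n) - 'X) <-> forall x, P.[x] = Q.[x].
Proof.
set M := _ - _; split=> [E x|E].
  rewrite (divp_eq P M) (divp_eq Q M) E !hornerD !hornerM field_poly_horner.
  by rewrite !mulr0.
apply/eqP; rewrite -subr_eq0; apply/eqP/poly_eq0_vanish => [|x].
  have sM : size M = (p ^ n).+1.
    rewrite /M size_polyDl ?size_polyXn // size_polyN size_polyX ltnS.
    exact: pn_gt1.
  have M0 : M != 0 by rewrite -size_poly_eq0 sM.
  rewrite -ltnS -sM; apply: leq_ltn_trans (size_polyD _ _) _.
  by rewrite size_polyN gtn_max !ltn_modp M0.
have H (R : {poly F}) : (R %% M).[x] = R.[x].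
  by rewrite [in RHS](divp_eq R M) hornerD hornerM field_poly_horner mulr0 add0r.
by rewrite hornerD hornerN !H E subrr.
Qed.

(** * Dembowski-Ostrom polynomials and their polar forms *)

Section DembowskiOstrom.

Variable g : {poly F}.
Hypothesis DO_g : dembowski_ostrom n g.

Lemma starE a b : star g a b = g.[b + a] - g.[b] - g.[a].
Proof. by rewrite /star /delta !hornerE horner_comp !hornerE. Qed.

Lemma star_formula : exists u : nat -> nat -> F, (forall a b, star g a b =
  \sum_(j < n) \sum_(i < n | (i <= j)%N)
    u i j * (a ^+ (p ^ i) * b ^+ (p ^ j) + b ^+ (p ^ i) * a ^+ (p ^ j))) /\
  forall a, g.[a] = \sum_(j < n) \sum_(i < n | (i <= j)%N)
    u i j * (a ^+ (p ^ i) * a ^+ (p ^ j)).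
Proof.
have [u gE] := DO_g; exists u.
have gh a : g.[a] = \sum_(j < n) \sum_(i < n | (i <= j)%N)
    u i j * (a ^+ (p ^ i) * a ^+ (p ^ j)).
  rewrite gE horner_sum; apply: eq_bigr => j _; rewrite horner_sum.
  by apply: eq_bigr => i _; rewrite hornerZ hornerXn exprD.
split=> // a b; rewrite starE !gh -!sumrB; apply: eq_bigr => j _.
rewrite -!sumrB; apply: eq_bigr => i _.
have D k : (b + a) ^+ (p ^ k) = b ^+ (p ^ k) + a ^+ (p ^ k).
  by have := expp_linear k 1 b a; rewrite !scale1r.
by rewrite !D; ring.
Qed.

Lemma star_comm : commutative (star g).
Proof. by move=> a b; rewrite !starE addrC addrAC [b + a]addrC addrC addrAC. Qed.

Lemma star_linear a : linear (star g a).
Proof.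
have [u [sE _]] := star_formula => c x y; rewrite !sE scaler_sumr -big_split /=.
apply: eq_bigr => j _; rewrite scaler_sumr -big_split /=.
apply: eq_bigr => i _; rewrite !expp_linear.
rewrite -[c *: (u i j * _)]mulr_algl -!(mulr_algl c (_ ^+ _)); ring.
Qed.

(** This recovers [g] from its polar form once 2 is invertible. *)
Lemma star_diag a : star g a a = g.[a] *+ 2.
Proof.
have [u [sE gE]] := star_formula; rewrite sE gE -sumrMnl; apply: eq_bigr => j _.
by rewrite -sumrMnl; apply: eq_bigr => i _; ring.
Qed.

Lemma starDl a b c : star g (a + b) c = star g a c + star g b c.
Proof.
by rewrite ![star g _ c]star_comm; have := star_linear c 1 a b; rewrite !scale1r.
Qed.

Hypothesis odd_p : odd p.

Lemma two_neq0 : 2%:R != 0 :> F.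
Proof.
rewrite -(dvdn_pcharf pchar_ext); apply: contraL odd_p => /(dvdn_leq (ltn0Sn 1)).
by case: (p) (prime_gt1 prime_p) => [|[|[|[]]]].
Qed.

(** A second difference removes the constants, the linearized summand and the shift [u], and leaves
    [L' (star (L x) (L y)) = 2 x y]. Conversely, [A] gives [L] and the doubled inverse of [C] gives
    [L'], both as linearized polynomials, with no affine correction. *)
Lemma ea_equivalent_square :
  ea_equivalent n g 'X^2 <-> strongly_isotopic (star g).
Proof.
split=> [[L [L' [L'' [u [v [w [[lL bL] [lL' bL'] lL'' /modp_field_poly E]]]]]]]|].
  have E' x : x ^+ 2 = L'.[g.[L.[x] + u]] + v + L''.[x] + w.
    by have := E x; rewrite !hornerE !horner_comp !hornerE.
  have DL x y : L.[x + y] = L.[x] + L.[y].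
    by have := linearized_linear lL 1 x y; rewrite !scale1r.
  have DL'' x y : L''.[x + y] = L''.[x] + L''.[y].
    by have := linearized_linear lL'' 1 x y; rewrite !scale1r.
  have lin' := linearized_linear lL'.
  pose f' : {linear F -> F} :=
    HB.pack (horner L') (GRing.isLinear.Build 'F_p F F _ _ lin').
  pose f : {linear F -> F} :=
    HB.pack (horner L) (GRing.isLinear.Build 'F_p F F _ _ (linearized_linear lL)).
  case: (bL') => h hK Kh.
  have lh : linear h.
    move=> a x y; apply: (bij_inj bL'); rewrite Kh.
    by rewrite -[RHS]/(f' _) linearP /= !Kh.
  have L0 (M : {poly F}) : linearized M -> M.[0] = 0.
    move=> lM; have := linearized_linear lM (-1) 0 0.
    by rewrite !scaleN1r oppr0 addr0 addNr.
  have S x y : f' (star g L.[x] L.[y]) = x * y *+ 2.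
    have -> : star g L.[x] L.[y] =
        g.[L.[x + y] + u] - g.[L.[x] + u] - g.[L.[y] + u] + g.[L.[0] + u].
      have -> : g.[L.[x + y] + u] = star g (L.[x] + u) L.[y] + g.[L.[y]] + g.[L.[x]
          + u].
        by rewrite starE DL [L.[y] + _]addrCA addrA; ring.
      have -> : g.[L.[y] + u] = star g u L.[y] + g.[L.[y]] + g.[u].
        by rewrite starE; ring.
      by rewrite starDl L0 // add0r; ring.
    rewrite !raddfD !raddfN /=.
    have G x1 : L'.[g.[L.[x1] + u]] = x1 ^+ 2 - v - L''.[x1] - w.
      by rewrite E'; ring.
    by rewrite !G DL'' [L''.[0]]L0 //; ring.
  (* The inverse of [L'] composed with doubling absorbs the factor 2 of the second difference. *)
  pose C0 (x : F) := h (x *+ 2).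
  have lC : linear C0.
    by move=> a x y; rewrite /C0 mulrnDl scalerMnr lh.
  pose C : {linear F -> F} := HB.pack C0 (GRing.isLinear.Build 'F_p F F _ _ lC).
  exists f, C; split=> //.
    apply: inj_bijective => x y; rewrite /= /C0 => /(can_inj Kh)/eqP.
    by rewrite -subr_eq0 -mulrnBl -mulr_natl mulf_eq0 (negbTE two_neq0) subr_eq0 =>
        /eqP.
  by move=> a b; rewrite /= /C0 -S /= hK.
case=> A [C [bA bC H]].
have [L lL LE] := linear_linearized (linearP A).
case: (bC) => h hK Kh.
(* Doubling turns [g] at [A x] into [star (A x) (A x)], that is [C (x * x)], which the inverse of
   [C] sends to the square. *)
pose D (x : F) := h (x *+ 2).
have lh : linear h.
  by move=> a x y; apply: (bij_inj bC); rewrite Kh linearP /= !Kh.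
have lD : linear D by move=> a x y; rewrite /D mulrnDl scalerMnr lh.
have [L' lL' LE'] := linear_linearized lD.
have l0 : linearized (0 : {poly F}) by exists 0%N, (fun=> 0); rewrite big_ord0.
exists L, L', 0, 0, 0, 0; split=> //.
- split=> //; apply: inj_bijective => x y; rewrite !LE; exact: bij_inj.
- split=> //; apply: inj_bijective => x y; rewrite !LE' /D => /(can_inj Kh)/eqP.
  by rewrite -subr_eq0 -mulrnBl -mulr_natl mulf_eq0 (negbTE two_neq0) subr_eq0 => /eqP.
apply/modp_field_poly => x; rewrite !addr0 !horner_comp hornerXn !LE LE' /D.
by rewrite -star_diag H hK expr2.
Qed.

End DembowskiOstrom.

End Polynomials.

(** * Correctness of the decision procedure *)

Local Open Scope ring_scope.

Section Coordinates.

Variables (p n : nat) (F : fieldExtType 'F_p) (e : n.-tuple F).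
Hypothesis basis_e : basis_of {: F} e.

Lemma vec_eq (a b : nat -> 'F_p) :
  (forall k, (k < n)%N -> a k = b k) -> vec e a = vec e b.
Proof. by move=> ab; apply: eq_bigr => k _; rewrite ab. Qed.

Lemma coord_vec (a : nat -> 'F_p) (k : 'I_n) : coord e k (vec e a) = a k.
Proof. exact: (coord_sum_free (fun k : 'I_n => a k) _ (basis_free basis_e)). Qed.

Lemma vec_inj (a b : nat -> 'F_p) : vec e a = vec e b ->
  forall k, (k < n)%N -> a k = b k.
Proof.
by move=> E k kn; rewrite -(coord_vec a (Ordinal kn)) E coord_vec.
Qed.

Definition cvec (x : F) (k : nat) : 'F_p := nth 0 (coords e x) k.

Lemma size_coords (x : F) : size (coords e x) = n.
Proof. by rewrite size_map size_enum_ord. Qed.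

Lemma cvecE (x : F) (k : 'I_n) : cvec x k = coord e k x.
Proof.
rewrite /cvec (nth_map k) ?size_enum_ord //; congr (coord _ _ _).
by apply: val_inj; rewrite /= nth_enum_ord.
Qed.

Lemma vecK (x : F) : vec e (cvec x) = x.
Proof.
rewrite [RHS](coord_expand basis_e); apply: eq_bigr => k _.
by rewrite cvecE.
Qed.

Lemma cvec_vec a k : (k < n)%N -> cvec (vec e a) k = a k.
Proof. by move=> kn; rewrite (cvecE _ (Ordinal kn)) coord_vec. Qed.

Lemma vecD a b : vec e (fun k => a k + b k) = vec e a + vec e b.
Proof. by rewrite -big_split; apply: eq_bigr => k _; rewrite scalerDl. Qed.

Lemma vecZ c a : vec e (fun k => c * a k) = c *: vec e a.
Proof. by rewrite scaler_sumr; apply: eq_bigr => k _; rewrite scalerA. Qed.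

Lemma vecB a b : vec e (fun k => a k - b k) = vec e a - vec e b.
Proof. by rewrite -sumrB; apply: eq_bigr => k _; rewrite scalerBl. Qed.

Lemma vec_sum m (x : 'I_m -> 'F_p) (a : 'I_m -> nat -> 'F_p) :
  vec e (fun k => \sum_(i < m) x i * a i k) = \sum_(i < m) x i *: vec e (a i).
Proof.
under [RHS]eq_bigr => i _ do rewrite -vecZ.
by rewrite exchange_big; apply: eq_bigr => k _; rewrite scaler_suml.
Qed.

Lemma vec_delta (i : 'I_n) : vec e (fun k => (k == i)%:R) = e`_i.
Proof.
rewrite /vec (bigD1 i) //= eqxx scale1r big1 ?addr0 // => k ki.
by rewrite (inj_eq val_inj) (negbTE ki) scale0r.
Qed.

Lemma vec_delta_nat i : (i < n)%N -> vec e (fun k => (k == i)%:R) = e`_i.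
Proof. by move=> iN; rewrite (vec_delta (Ordinal iN)). Qed.

Lemma vec0 : vec e (fun=> 0) = 0.
Proof. by rewrite /vec big1 // => k _; rewrite scale0r. Qed.

End Coordinates.

(** The second matrix has [n + 1] rows and [n] columns, so stride and width are reset before the
    second elimination. *)
Definition decision : cmd :=
  CSeq gauss (CIf (TEq (IReg rFLAG) (IConst 0)) CSkip
    (CSeq assoc_check (CIf (TEq (IReg rFLAG) (IConst 0)) CSkip
      (CSeq frobenius (CSeq build
        (CSeq (CSetI rSTR (IAdd (IReg rN) (IConst 1)))
          (CSeq (CSetI rW (IReg rN))
            (CSeq (CSetI rFLAG (IConst 1)) gauss)))))))).

Definition Tdecision (n m : nat) : nat :=
  (50 + (Tgauss n n (n * n) + Tassoc n + Tfrobenius n m + Tbuild n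
        + Tgauss n n.+1 n))%N.

Section Decision.

Variables (p n : nat) (F : fieldExtType 'F_p) (e : n.-tuple F).
Hypothesis prime_p : prime p.
Hypothesis n_gt0 : (0 < n)%N.
Hypothesis basis_e : basis_of {: F} e.

Variable star : F -> F -> F.
Hypothesis starC : commutative star.
Hypothesis starP : forall x, linear (star x).

Local Notation u := e`_0.

Lemma unit_neq0 : u != 0.
Proof. by apply: (basis_not0 basis_e); rewrite mem_nth // size_tuple. Qed.

Lemma star_sum x m (v : 'I_m -> F) :
  star x (\sum_(i < m) v i) = \sum_(i < m) star x (v i).
Proof.
pose f : {linear F -> F} := HB.pack (star x) (GRing.isLinear.Build 'F_p F F _ _
    (starP x)).
by rewrite -[LHS]/(f _) linear_sum.
Qed.

Lemma star_sumr x m (c : 'I_m -> 'F_p) (v : 'I_m -> F) :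
  star x (\sum_(i < m) c i *: v i) = \sum_(i < m) c i *: star x (v i).
Proof.
pose f : {linear F -> F} := HB.pack (star x) (GRing.isLinear.Build 'F_p F F _ _
    (starP x)).
rewrite -[LHS]/(f _) linear_sum; apply: eq_bigr => i _.
by rewrite linearZ.
Qed.

Lemma star_r0 x : star x 0 = 0.
Proof.
by have := star_sum x (fun _ : 'I_0 => 0); rewrite !big_ord0.
Qed.

Lemma star_vec a b : star (vec e a) (vec e b) =
  \sum_(i < n) \sum_(j < n) (a i * b j) *: star e`_i e`_j.
Proof.
rewrite starC star_sumr; apply: eq_bigr => i _.
rewrite starC star_sumr scaler_sumr; apply: eq_bigr => j _.
by rewrite scalerA.
Qed.

Variable S : nat -> 'F_p.
Hypothesis SE : forall i j k, (i < n)%N -> (j < n)%N -> (k < n)%N ->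
  S (cell3 n i j k) = cvec e (star e`_i e`_j) k.

Lemma star_entries i j : (i < n)%N -> (j < n)%N ->
  star e`_i e`_j = vec e (fun k => S (cell3 n i j k)).
Proof.
move=> iN jN; rewrite -(vecK basis_e (star _ _)); apply: vec_eq => k kn.
by rewrite SE.
Qed.

(** The first [n] columns of [S] are the products of [e_0] with the basis, so on vectors supported
    there the matrix is that of [star u]. *)
Lemma kernel_star (x : nat -> 'F_p) : (forall c, (n <= c)%N -> x c = 0) ->
  in_kernel n (n * n) S x <-> star u (vec e x) = 0.
Proof.
move=> x0.
have nn : (n <= n * n)%N by rewrite leq_pmulr.
have E r : \sum_(c < n * n) x c * S (c * n + r)%N =
    \sum_(c < n) x c * S (c * n + r)%N.
  rewrite -(big_mkord xpredT (fun c => x c * S (c * n + r)%N)).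
  rewrite (big_cat_nat (n := n)) //= big_mkord [X in _ + X]big1_seq ?addr0 //.
  by move=> c; rewrite mem_index_iota => /andP[_ /andP[nc _]]; rewrite x0 ?mul0r.
have V : star u (vec e x) = vec e (fun r => \sum_(c < n) x c * S (c * n + r)%N).
  rewrite star_sumr vec_sum; apply: eq_bigr => c _.
  by rewrite star_entries.
split=> [H|].
  rewrite V -[RHS](vec0 e); apply: vec_eq => r rn.
  by rewrite -E H.
rewrite V -(vec0 e) => /(vec_inj basis_e) H r rn.
by rewrite E H.
Qed.

Lemma dependent_not_iso : dependent n n (n * n) S -> ~ strongly_isotopic star.
Proof.
case=> x [/[dup] kx + x0 [c cn xc]] => _ /strongly_isotopic_isotopic iso.
have [inj _] := isotopic_quot starC unit_neq0 iso.
have : star u (vec e x) = star u 0.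
  by rewrite ((kernel_star x0).1 kx) star_r0.
move/inj; rewrite -(vec0 e) => /(vec_inj basis_e)/(_ c cn) E.
by rewrite E eqxx in xc.
Qed.

Definition table_mul (T : nat -> 'F_p) (x y : F) : F :=
  \sum_(i < n) \sum_(j < n)
    (cvec e x i * cvec e y j) *: vec e (fun k => T (cell3 n i j k)).

(** * The product read from the reduced matrix *)

Section Reduced.

Variable T : nat -> 'F_p.
Hypothesis T_ker : same_kernel n (n * n) T S.
Hypothesis T_red : reduced n n T.

Local Notation mul := (table_mul T).

(** An element killed by [star u], padded with zeros, lies in the kernel of [S] and so in that of
    [T], whose first [n] columns are unit vectors. *)
Lemma reduced_inj : injective (star u).
Proof.
have nn : (n <= n * n)%N by rewrite leq_pmulr.
pose f : {linear F -> F} := HB.pack (star u) (GRing.isLinear.Build 'F_p F F _ _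
    (starP u)).
move=> x y /eqP; rewrite -subr_eq0 -[star u x]/(f x) -[star u y]/(f y) -raddfB /=.
set z := x - y => /eqP z0; apply/eqP; rewrite -subr_eq0 -/z; apply/eqP.
pose a k := if (k < n)%N then cvec e z k else 0.
have az : vec e a = z.
  by rewrite -(vecK basis_e z); apply: vec_eq => k kn; rewrite /a kn.
have a0 c : (n <= c)%N -> a c = 0 by rewrite /a ltnNge => ->.
have /T_ker ka : in_kernel n (n * n) S a by apply/kernel_star; rewrite ?az.
rewrite -az -(vec0 e); apply: vec_eq => k kn; have := ka k kn.
rewrite (bigD1 (Ordinal (leq_trans kn nn))) //= T_red // eqxx mulr1.
rewrite big1 ?addr0 // => c ck.
have [cn|nc] := ltnP c n; last by rewrite a0 ?mul0r.
rewrite T_red // (_ : (k == c :> nat) = false) ?mulr0 //.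
by apply/negbTE; move: ck; rewrite -val_eqE eq_sym.
Qed.

(** Column [c] of [T] is a combination of the first [n] columns with its own entries as
    coefficients. Equal kernels mean equal column relations, so the same combination holds in [S],
    where it reads [e_i star e_j = star u] of column [c] of [T]. *)
Lemma mulE x y : star x y = star u (mul x y).
Proof.
have nn : (n <= n * n)%N by rewrite leq_pmulr.
rewrite -{1}(vecK basis_e x) -{1}(vecK basis_e y) star_vec /mul.
rewrite star_sum; apply: eq_bigr => i _; rewrite star_sumr.
apply: eq_bigr => j _; congr (_ *: _).
set c := (i * n + j)%N.
have cW : (c < n * n)%N by rewrite /c; have := ltn_ord i; have := ltn_ord j; nia.
have cE k : cell3 n i j k = (c * n + k)%N by rewrite /cell3 /c; lia.
(* The column relation as a kernel vector; for [c < n] the two terms cancel and it is zero. *)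
pose z (c' : nat) : 'F_p := (c' == c)%:R - (if (c' < n)%N then T (c * n + c')%N else 0).
have sumz (A : nat -> 'F_p) r : \sum_(c' < n * n) z c' * A (c' * n + r)%N =
    A (c * n + r)%N - \sum_(c' < n) T (c * n + c')%N * A (c' * n + r)%N.
  under eq_bigr => c' _ do rewrite mulrBl; rewrite sumrB; congr (_ - _).
    rewrite (bigD1 (Ordinal cW)) //= eqxx mul1r big1 ?addr0 // => c' ne.
    by rewrite (_ : (c' == c :> nat) = false) ?mul0r //; apply/negbTE.
  rewrite -(big_mkord xpredT (fun c' => (if (c' < n)%N then T (c * n + c')%N else
      0) * A (c' * n + r)%N)).
  rewrite (big_cat_nat (n := n)) //= big_mkord [X in _ + X]big1_seq ?addr0 //.
    by apply: eq_bigr => c' _; rewrite ltn_ord.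
  move=> c'; rewrite mem_index_iota => /andP[_ /andP[nc _]].
  by rewrite ltnNge nc mul0r.
have /T_ker kz : in_kernel n (n * n) T z.
  move=> r rn; rewrite sumz (bigD1 (Ordinal rn)) //= (@T_red r r) // eqxx mulr1.
  rewrite big1 ?addr0 ?subrr // => c' ne; rewrite (@T_red c' r) //.
  rewrite (_ : (r == c' :> nat) = false) ?mulr0 //.
  by apply/negbTE; move: ne; rewrite -val_eqE eq_sym.
rewrite star_entries // star_sumr.
under [RHS]eq_bigr => k _ do rewrite star_entries //.
rewrite -vec_sum; apply: vec_eq => r rn; apply/eqP; rewrite -subr_eq0; apply/eqP.
have := kz r rn; rewrite sumz cE => E; rewrite -[RHS]E; congr (_ - _).
by apply: eq_bigr => k _; rewrite cE.
Qed.

Let mul_vec a b : mul (vec e a) (vec e b) =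
  \sum_(i < n) \sum_(j < n) (a i * b j) *: vec e (fun k => T (cell3 n i j k)).
Proof.
by apply: eq_bigr => i _; apply: eq_bigr => j _; rewrite !cvec_vec.
Qed.

Let mul_linear x : linear (mul x).
Proof.
move=> c y z; apply: reduced_inj; rewrite starP -!mulE starP //.
Qed.

Let mulC : commutative mul := quotC starC reduced_inj mulE.

Let mul_basis (i j : 'I_n) : mul e`_i e`_j = vec e (fun k => T (cell3 n i j k)).
Proof.
rewrite -!(vec_delta e) mul_vec (bigD1 i) //= (bigD1 j) //= !eqxx mulr1 scale1r.
rewrite big1 ?addr0 => [|j' ne]; last first.
  by rewrite (inj_eq val_inj) (negbTE ne) mulr0 scale0r.
rewrite big1 ?addr0 // => i' ne; apply: big1 => j' _.
by rewrite (inj_eq val_inj) (negbTE ne) mul0r scale0r.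
Qed.

Let mul_sumr x m (c : 'I_m -> 'F_p) (v : 'I_m -> F) :
  mul x (\sum_(i < m) c i *: v i) = \sum_(i < m) c i *: mul x (v i).
Proof.
pose f : {linear F -> F} := HB.pack (mul x) (GRing.isLinear.Build 'F_p F F _ _
    (mul_linear x)).
rewrite -[LHS]/(f _) linear_sum; apply: eq_bigr => i _.
by rewrite linearZ.
Qed.

Lemma assoc_lcomm :
  (forall i, (i < n)%N -> forall j, (j < n)%N -> forall k, (k < n)%N ->
   forall l, (l < n)%N -> assoc_eq n T i j k l) <->
  forall x y z, mul x (mul y z) = mul y (mul x z).
Proof.
have B (i j k : 'I_n) : mul e`_i (mul e`_j e`_k) =
    vec e (fun l => \sum_(m < n) T (cell3 n j k m) * T (cell3 n i m l)).
  rewrite mul_basis mul_sumr vec_sum; apply: eq_bigr => m _.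
  by rewrite mul_basis.
have AE i j k l : assoc_eq n T i j k l <->
    \sum_(m < n) T (cell3 n j k m) * T (cell3 n i m l) =
    \sum_(m < n) T (cell3 n i k m) * T (cell3 n j m l).
  by rewrite /assoc_eq sumrB; split=> [/eqP|->]; rewrite ?subrr // subr_eq0 => /eqP.
split=> [H x y z|H i iN j jN k kN l lN].
  have Hb (i j k : 'I_n) : mul e`_i (mul e`_j e`_k) = mul e`_j (mul e`_i e`_k).
    by rewrite !B; apply: vec_eq => l ln; apply/AE/H.
  have lin2 x1 y1 : linear (fun z1 => mul x1 (mul y1 z1)).
    by move=> c z1 z2; rewrite !mul_linear.
  have lin1 x1 z1 : linear (fun y1 => mul x1 (mul y1 z1)).
    by move=> c y1 y2; rewrite ![mul _ z1]mulC !mul_linear.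
  have lin0 y1 z1 : linear (fun x1 => mul x1 (mul y1 z1)).
    by move=> c x1 x2; rewrite ![mul _ (mul y1 z1)]mulC !mul_linear.
  (* Both sides are trilinear, so the variables [z], [y], [x] are restricted to the basis one after
     the other. *)
  apply: (linear_eq_basis basis_e (lin2 x y) (lin2 y x)) => k.
  apply: (linear_eq_basis basis_e (lin1 x e`_k) (lin0 x e`_k)) => j.
  exact: (linear_eq_basis basis_e (lin0 e`_j e`_k) (lin1 e`_j e`_k)).
apply/AE; have := H e`_i e`_j e`_k.
by rewrite (B (Ordinal iN) (Ordinal jN) (Ordinal kN)) (B (Ordinal jN) (Ordinal iN)
    (Ordinal kN)) => /(vec_inj basis_e)/(_ l lN).
Qed.

Lemma not_assoc_not_iso :
  ~ (forall i, (i < n)%N -> forall j, (j < n)%N -> forall k, (k < n)%N ->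
   forall l, (l < n)%N -> assoc_eq n T i j k l) -> ~ strongly_isotopic star.
Proof.
move=> nH /strongly_isotopic_isotopic iso; apply/nH/assoc_lcomm.
exact: (isotopic_lcomm starC unit_neq0 iso mulE).
Qed.

(** * The Frobenius test on the algebra *)

Section Associative.

Hypothesis lcomm : forall x y z, mul x (mul y z) = mul y (mul x z).

Definition star_alg : fp_alg F := quot_alg starC starP unit_neq0 reduced_inj mulE lcomm.

Local Notation A := (alg_ring star_alg).

Definition avec (a : nat -> 'F_p) : A := vec e a.

Lemma avec_mul (a b c : nat -> 'F_p) :
  (forall k, (k < n)%N -> c k =
    \sum_(i < n) \sum_(j < n) a i * b j * T (cell3 n i j k)) ->
  avec c = avec a * avec b.
Proof.
move=> cE; rewrite -[RHS]/(mul (vec e a) (vec e b)) mul_vec /avec (vec_eq e cE).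
rewrite exchange_big /=.
under [RHS]eq_bigr => j _ do rewrite -vec_sum.
rewrite -[LHS]/(vec e _).
(* The factor 1 brings the sum into the shape required by [vec_sum]. *)
transitivity (vec e (fun k => \sum_(j < n) 1 * \sum_(i < n) a i * b j * T (cell3 n
    i j k))).
  apply: vec_eq => k kn; rewrite exchange_big; apply: eq_bigr => j _ /=.
  by rewrite mul1r.
by rewrite vec_sum; apply: eq_bigr => j _; rewrite scale1r.
Qed.

Lemma avec_one : avec (fun k => (k == 0%N)%:R) = 1.
Proof. exact: vec_delta_nat. Qed.

Variables (Phi G : nat -> 'F_p).
Hypothesis PhiE : forall i, (i < n)%N ->
  avec (fun k => Phi (i * n + k)%N) = avec (fun k => (k == i)%:R) ^+ p.
Hypothesis GE : forall c, (c < n)%N -> G (c * n.+1)%N = (c == 0%N)%:R /\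
  forall k, (k < n)%N -> G (c * n.+1 + k.+1)%N =
    \sum_(m < n) Phi (c * n + m)%N * Phi (m * n + k)%N - Phi (c * n + k)%N.

Lemma avec_expp (a : nat -> 'F_p) :
  avec a ^+ p = avec (fun k => \sum_(i < n) a i * Phi (i * n + k)%N).
Proof.
rewrite [RHS](vec_sum e (fun i : 'I_n => a i) (fun i k => Phi (i * n + k)%N)).
have -> : avec a = \sum_(i < n) a i *: avec (fun k => (k == i)%:R).
  by apply: eq_bigr => i _; congr (_ *: _); exact/esym/vec_delta.
rewrite -[LHS]/(pFrobenius_aut (pchar_alg_ring star_alg prime_p) _) rmorph_sum.
apply: eq_bigr => i _.
rewrite /= pFrobenius_autE (alg_exppZ prime_p); congr (_ *: _).
by rewrite -PhiE.
Qed.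

(** Row 0 extracts the coordinate [x 0], and row [k + 1] gives coordinate [k] of phi (phi x) - phi
    x. *)
Lemma kernel_frobenius (x : nat -> 'F_p) :
  in_kernel n.+1 n G x <-> x 0%N = 0 /\ avec x ^+ p ^+ p = avec x ^+ p.
Proof.
have row0 : \sum_(c < n) x c * G (c * n.+1 + 0)%N = x 0%N.
  rewrite (bigD1 (Ordinal n_gt0)) //= big1 ?addr0 => [|c c0].
    by have [-> _] := GE n_gt0; rewrite mulr1.
  rewrite addn0; have [-> _] := GE (ltn_ord c).
  by rewrite (_ : (c == 0%N :> nat) = false) ?mulr0 //; apply/negbTE.
have rowS k : (k < n)%N -> \sum_(c < n) x c * G (c * n.+1 + k.+1)%N =
    \sum_(m < n) (\sum_(c < n) x c * Phi (c * n + m)%N) * Phi (m * n + k)%N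
    - \sum_(c < n) x c * Phi (c * n + k)%N.
  move=> kn; under eq_bigr => c _ do rewrite (proj2 (GE (ltn_ord c))) // mulrBr
      mulr_sumr.
  rewrite sumrB exchange_big; congr (_ - _); apply: eq_bigr => m _.
  by rewrite mulr_suml; apply: eq_bigr => c _; rewrite mulrA.
rewrite !avec_expp; split=> [H|[x0 /(vec_inj basis_e) E]].
  split; first by rewrite -row0 H.
  apply: vec_eq => k kn; apply/eqP; rewrite -subr_eq0; apply/eqP.
  by rewrite -rowS // H.
case=> [|k] kn; first by rewrite row0.
by rewrite rowS // E // subrr.
Qed.

(** Under an isotopy the kernel vector would be a multiple of the unit [e_0], but its coordinate at
    [e_0] is zero. *)
Lemma dependent_frobenius_not_iso :
  dependent n n.+1 n G -> ~ strongly_isotopic star.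
Proof.
case=> x [/kernel_frobenius[x0 fx] _ [c cn xc]] /strongly_isotopic_isotopic iso.
have [a Ea] := isotopic_fixed prime_p starC unit_neq0 iso (m := star_alg) mulE erefl fx.
move: Ea; rewrite -avec_one -[RHS](vecZ e) => /(vec_inj basis_e) E.
have := E 0%N n_gt0; rewrite eqxx mulr1 x0 => a0.
by move: xc; rewrite E // -a0 mul0r eqxx.
Qed.

Lemma reduced_frobenius_iso (G' : nat -> 'F_p) :
  same_kernel n.+1 n G' G -> reduced n n.+1 G' -> strongly_isotopic star.
Proof.
move=> sk red.
apply: (quot_strongly_isotopic prime_p (starC := starC) (starP := starP)
  (u0 := unit_neq0) (inj_u := reduced_inj) (mulE := mulE) (mul_lcomm := lcomm)).
move=> y fy.
(* Subtracting from [y] its component along [e_0] yields a kernel vector, which the reduced matrix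
   forces to be zero; so [y] is this scalar. *)
pose a := cvec e y 0%N; exists a.
pose b k := cvec e y k - a * (k == 0%N)%:R.
have bE : avec b = (y : A) - a *: 1.
  by rewrite -avec_one /avec vecB vecZ vecK.
have /sk kb : in_kernel n.+1 n G b.
  apply/kernel_frobenius; split; first by rewrite /b eqxx mulr1 subrr.
  by rewrite bE !(alg_exppB prime_p) !(alg_exppZ prime_p) !expr1n fy.
suff b0 : avec b = 0 by apply/eqP; rewrite -subr_eq0 -[_ - _]bE b0.
transitivity (vec e (fun=> 0)); last exact: vec0.
apply: vec_eq => k kn.
have kn1 : (k < n.+1)%N := ltnW kn.
have := kb k kn1; rewrite (bigD1 (Ordinal kn)) //= red // eqxx mulr1.
rewrite big1 ?addr0 // => c ck; rewrite red //.
rewrite (_ : (k == c :> nat) = false) ?mulr0 //.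
by apply/negbTE; move: ck; rewrite -val_eqE eq_sym.
Qed.

End Associative.

End Reduced.

Variable oracle : (nat -> 'F_p) -> seq 'F_p.

Lemma decision_runs m (s : state 'F_p) : sized n s -> regs s rW = (n * n)%N ->
  regs s rFLAG = 1%N -> regs s 1 = p -> (p < 2 ^ m)%N -> arrays s 1 = S ->
  runs oracle decision s (Tdecision n m) 0
    (fun s' => regs s' rFLAG != 0%N <-> strongly_isotopic star).
Proof.
move=> sz sW sF s1p pm sS; have [sn st s2] := sz.
have nn : (n <= n * n)%N by rewrite leq_pmulr.
pose T1 := (Tfrobenius n m + (Tbuild n + (4 + (2 + (2 + Tgauss n n.+1 n)))))%N.
pose T0 := (Tgauss n n (n * n) + (4 + (0 + (Tassoc n + (4 + (0 + T1))))))%N.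
apply: (runs_cost (T := T0) (q := 0)) => //; last first.
  by rewrite /T0 /T1 /Tdecision; lia.
apply: (runs_seq (q1 := 0) (q2 := 0)).
apply: (runs_imp (gauss_runs _ sn st sW sF (leqnn n) nn)) => t so [[f1 sk red]|[f0
    dep]]; last first.
  apply: (runs_if (T1 := 0) (q1 := 0) (q2 := 0)) => /=; rewrite f0 // => _.
  apply: runs_skip; rewrite f0; split=> // iso; rewrite sS in dep.
  by case: (dependent_not_iso dep iso).
rewrite sS in sk.
apply: (runs_if (T1 := 0) (q1 := 0) (q2 := 0)) => /=; rewrite f1 // => _.
have szt : sized n t by apply: (sized_same_off sz so).
apply: (runs_seq (q1 := 0) (q2 := 0)).
apply: (runs_imp (assoc_check_runs _ szt)) => t1 so1 fl1.
apply: (runs_if (T1 := 0) (q1 := 0) (q2 := 0)) => /= fl.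
  apply: runs_skip; rewrite (eqP fl); split=> // iso.
  exfalso; apply: (not_assoc_not_iso sk red _ iso) => H.
  have : regs t1 5 != 0%N by apply/fl1; rewrite f1.
  by rewrite (eqP fl).
have [_ /(assoc_lcomm sk red) lc] := fl1.1 fl.
have szt1 : sized n t1 by apply: (sized_same_off szt so1).
have aT : arrays t1 1 = arrays t 1 by rewrite so1.2.
apply: (runs_seq (q1 := 0) (q2 := 0)).
apply: (runs_imp (@frobenius_runs _ oracle _ (avec sk red lc) n (arrays t 1) _ _ _
    m p t1 szt1 aT _ pm)).
- by move=> a b; apply: vec_eq.
- exact: avec_mul.
- exact: avec_one.
- by rewrite so1.1 // so.1.
move=> t2 so2 PhiE.
have szt2 : sized n t2 by apply: (sized_same_off szt1 so2).
apply: (runs_seq (q1 := 0) (q2 := 0)).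
apply: (runs_imp (build_runs _ n_gt0 szt2)) => t3 so3 GE.
have szt3 : sized n t3 by apply: (sized_same_off szt2 so3).
have [tn _ _] := szt3.
apply: (runs_seq (q1 := 0) (q2 := 0)); apply: runs_setI.
apply: (runs_seq (q1 := 0) (q2 := 0)); apply: runs_setI.
apply: (runs_seq (q1 := 0) (q2 := 0)); apply: runs_setI.
apply: (runs_imp (gauss_runs (n := n) (R := n.+1) (W := n) _ _ _ _ _ _ _)) => //=.
- by rewrite /upd /= tn addn1.
- move=> t4 so4 [[f4 sk4 red4]|[f4 dep4]]; rewrite f4; split=> //.
    by move=> _; apply: (reduced_frobenius_iso PhiE GE sk4 red4).
  by move=> iso; case: (dependent_frobenius_not_iso PhiE GE dep4 iso).
Qed.

End Decision.

(** * Total cost *)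

Local Open Scope nat_scope.

(** Here [l] stands for the logarithm of [p]; positivity of [n] and [l] lets constants be absorbed
    into the product. *)
Definition bounded (k : nat) (T : nat -> nat -> nat) : Prop :=
  exists C, forall n l, 0 < n -> 0 < l -> T n l <= C * (n ^ k * l).

Lemma bounded_const k c : bounded k (fun _ _ => c).
Proof.
exists c => n l n0 l0; rewrite -{1}(muln1 c) leq_mul2l.
by rewrite muln_gt0 expn_gt0 n0 l0 orbT.
Qed.

Lemma bounded_add k T U : bounded k T -> bounded k U ->
  bounded k (fun n l => T n l + U n l).
Proof.
move=> [C HT] [D HU]; exists (C + D) => n l n0 l0.
by rewrite mulnDl leq_add ?HT ?HU.
Qed.

Lemma bounded_weaken k k' T : k <= k' -> bounded k T -> bounded k' T.
Proof.
move=> kk [C HT]; exists C => n l n0 l0; apply: leq_trans (HT _ _ n0 l0) _.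
by rewrite leq_mul2l leq_mul2r leq_pexp2l ?orbT.
Qed.

(** The factor 2 admits loops of length [n + 1]. *)
Lemma bounded_for k j N T : (forall n, 0 < n -> N n <= 2 * n ^ j) ->
  bounded k T -> bounded (j + k) (fun n l => Tfor (N n) (T n l)).
Proof.
move=> HN [C HT]; exists (2 * (C + 16) + 10) => n l n0 l0.
rewrite /Tfor mulnDl; apply: leq_add; last first.
  by rewrite -{1}(muln1 10) leq_mul2l muln_gt0 expn_gt0 n0 l0.
rewrite expnD -!mulnA [(C + 16) * _]mulnCA mulnA.
apply: leq_mul; first exact: HN.
rewrite mulnDl leq_add ?HT //.
by rewrite -{1}(muln1 16) leq_mul2l muln_gt0 expn_gt0 n0 l0.
Qed.

Lemma bounded_forn k T : bounded k T -> bounded k.+1 (fun n l => Tfor n (T n l)).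
Proof. by apply: (bounded_for (j := 1)) => n _; rewrite expn1 leq_pmull. Qed.

Lemma bounded_forS k T : bounded k T -> bounded k.+1 (fun n l => Tfor n.+1 (T n l)).
Proof. by apply: (bounded_for (j := 1)) => n n0; rewrite expn1; lia. Qed.

Lemma bounded_fornn k T :
  bounded k T -> bounded k.+2 (fun n l => Tfor (n * n) (T n l)).
Proof. by apply: (bounded_for (j := 2)) => n n0; rewrite mulnn leq_pmull. Qed.

Ltac bnd := repeat first
  [ assumption | exact: bounded_const
  | apply: bounded_forn | apply: bounded_forS | apply: bounded_fornn
  | apply: bounded_add ].

(** There are [l + 1] halvings, at most [2 * l], and each costs a bounded number of products of
    order [n ^ 3]. *)
Lemma bounded_pow k : 3 <= k -> bounded k (fun n l => Tpow n l.+1).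
Proof.
move=> k3.
have [C HC] : bounded k (fun n _ => Tpow_step n).
  by apply: (bounded_weaken k3); rewrite /Tpow_step /Tmulv; bnd.
exists (2 * (C + 10) + 10) => n l n0 l0; rewrite /Tpow mulnDl.
have nk : 0 < n ^ k by rewrite expn_gt0 n0.
apply: leq_add; last by rewrite -{1}(muln1 10) leq_mul2l muln_gt0 nk l0.
have := HC n 1 n0 isT; rewrite muln1 => H.
rewrite [n ^ k * l]mulnC mulnA -[2 * _ * l]mulnA [(C + 10) * l]mulnC mulnA -mulnA.
apply: leq_mul; first by lia.
rewrite mulnDl leq_add // -{1}(muln1 10) leq_mul2l nk.
by rewrite orbT.
Qed.

(** The exponent 7 leaves room: the largest contributions are of order [n ^ 5] from the
    associativity test and [n ^ 4 * l] from the Frobenius matrix. *)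
Lemma bounded_total (T : nat -> nat) : bounded 3 (fun n _ => T n) ->
  bounded 7 (fun n l =>
    20 + Tfor n 1 + (Tfor n (Tfor n (T n)) + (Tdecision n l.+1 + 2))).
Proof.
move=> HT; rewrite /Tdecision /Tgauss /Tassoc /Tfrobenius /Tbuild.
have HT5 : bounded 5 (fun n _ => T n) by apply: bounded_weaken HT.
have HP : bounded 6 (fun n l => Tpow n l.+1) by apply: bounded_pow.
by repeat first [ assumption | exact: bounded_const
  | apply: bounded_forn | apply: bounded_forS | apply: bounded_fornn
  | apply: bounded_add ].
Qed.

Local Open Scope ring_scope.

(** * The complete programs *)

Section Main.

Variables (p n : nat) (F : fieldExtType 'F_p) (e : n.-tuple F) (g : {poly F}).
Hypothesis prime_p : prime p.
Hypothesis n_gt0 : (0 < n)%N.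
Hypothesis basis_e : basis_of {: F} e.
Hypothesis DO_g : dembowski_ostrom n g.

(** Register 0 holds [n] on input and the answer on output, so the flag lives in a register of its
    own and is copied at the end. *)
Definition decide_program (query : cmd) : cmd :=
  CSeq setup (CSeq (fill query) (CSeq decision (CSetI 0 (IReg rFLAG)))).

Lemma cvecB (x y : F) k : (k < n)%N -> cvec e (x - y) k = cvec e x k - cvec e y k.
Proof. by move=> kn; rewrite !(cvecE _ _ (Ordinal kn)) linearB. Qed.

Lemma decide_program_decides (oracle : (nat -> 'F_p) -> seq 'F_p) query T q :
  okfor 13 rN query -> okfor 10 rN (cfor 13 rN query) ->
  rFLAG \notin modr query -> rW \notin modr query -> 1%N \notin modr query ->
  (forall i j s1, (i < n)%N -> (j < n)%N -> sized n s1 -> regs s1 10 = i ->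
     regs s1 12 = (i * (n * n))%N -> regs s1 13 = j -> regs s1 14 = (j * n)%N ->
     runs oracle query s1 T q (fun s' =>
    (forall k, (k < n)%N ->
      arrays s' 1 (cell3 n i j k) = cvec e (star g e`_i e`_j) k) /\
    (forall i' j' k, (j' < n)%N -> (k < n)%N -> (i', j') != (i, j) ->
      arrays s' 1 (cell3 n i' j' k) = arrays s1 1 (cell3 n i' j' k)))) ->
  forall (P : Prop) (B Q : nat),
  (20 + Tfor n 1 + (Tfor n (Tfor n T)
     + (Tdecision n (trunc_log 2 p).+1 + 2)) <= B)%N ->
  (n * (n * q) <= Q)%N -> (strongly_isotopic (star g) <-> P) ->
  decides oracle (decide_program query) (input e) P B Q.
Proof.
move=> ok1 ok2 mF mW m1 H P B Q hB hQ hP.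
have [k [s' [E t1 q1 R]]] : runs oracle (decide_program query) (input e)
    (20 + Tfor n 1 + (Tfor n (Tfor n T) + (Tdecision n (trunc_log 2 p).+1 + 2)))
    (0 + (n * (n * q) + (0 + 0)))
    (fun s' => regs s' 0 != 0%N <-> strongly_isotopic (star g)); last first.
  have tB := leq_trans t1 hB.
  exists k, s'; split=> //; first by rewrite R.
  - exact: leq_trans (leq_addr _ _) tB.
  - exact: leq_trans (leq_addl _ _) tB.
  - by apply: leq_trans hQ; move: q1; rewrite !addn0.
apply: runs_seq; apply: (runs_imp (setup_runs (n := n) _ _)) => // s1 so1 [sz1 W1
    F1 p1].
apply: runs_seq; apply: (runs_imp (fill_runs (v := fun i j => cvec e (star g e`_i
    e`_j)) ok1 ok2 sz1 H)).
move=> s2 so2 E2.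
have keep r : r \notin [:: 10; 11; 12; 13; 14; 15] -> r \notin modr query ->
    regs s2 r = regs s1 r.
  rewrite !inE !negb_or => /and5P[a b c d /andP[f h]] rq; rewrite so2.1 //=.
  by rewrite ?(inE, mem_cat) !negb_or ?a ?b ?c ?d ?f ?h rq.
have sz2 : sized n s2 by apply: (sized_for ok2 sz1 so2).
apply: runs_seq.
apply: (runs_imp (decision_runs (m := (trunc_log 2 p).+1) (S := arrays s2 1)
    prime_p n_gt0 basis_e
   (star_comm g) (star_linear prime_p DO_g) _ oracle sz2 _ _ _ _ erefl)).
- by move=> i j k iN jN kn; rewrite E2.
- by rewrite keep.
- by rewrite keep.
- by rewrite keep.
- by rewrite trunc_log_ltn.
by move=> s3 so3 E3; apply: runs_setI.
Qed.

End Main.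

Theorem mainTheorem6 :
  (exists (algo : cmd) (C : nat),
     forall (p n : nat) (F : fieldExtType 'F_p) (e : n.-tuple F) (g : {poly F}),
       prime p -> odd p -> (0 < n)%N -> basis_of {: F} e ->
       dembowski_ostrom n g ->
       decides (eval_oracle e g) algo (input e)
         (ea_equivalent n g 'X^2)
         (C * (n ^ 7 * trunc_log 2 p))%N (C * n ^ 2)%N)
  /\
  (exists (algo : cmd) (C : nat),
     forall (p n : nat) (F : fieldExtType 'F_p) (e : n.-tuple F) (g : {poly F}),
       prime p -> odd p -> (0 < n)%N -> basis_of {: F} e ->
       dembowski_ostrom n g -> planar g ->
       decides (mul_oracle e (star g)) algo (input e)
         (isotopic (star g) (fun a b : F => a * b))
         (C * (n ^ 7 * trunc_log 2 p))%N (C * n ^ 2)%N).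
Proof.
have l_gt0 p : prime p -> (0 < trunc_log 2 p)%N.
  by move=> pp; rewrite trunc_log_gt0 /= prime_gt1.
split.
- have [C HC] : bounded 7 (fun n l => 20 + Tfor n 1 + (Tfor n (Tfor n (Tpolarize n))
      + (Tdecision n l.+1 + 2)))%N.
    apply: bounded_total; rewrite /Tpolarize; bnd.
  (* The 3 accounts for the queries at [e_i], [e_j] and [e_i + e_j] for each pair of indices. *)
  exists (decide_program polarize), (C + 3)%N => p n F e g pp po n0 be DOg.
  have S i j k : (i < n)%N -> (j < n)%N -> (k < n)%N ->
      nth 0 (eval_oracle e g (fun k => (k == i)%:R + (k == j)%:R)) k
      - nth 0 (eval_oracle e g (fun k => (k == j)%:R)) k
      - nth 0 (eval_oracle e g (fun k => (k == i)%:R)) k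
      = cvec e (star g e`_i e`_j) k.
    move=> iN jN kn; rewrite /eval_oracle vecD !vec_delta_nat // -!cvecB //.
    by rewrite starE [e`_j + _]addrC.
  apply: (decide_program_decides (T := Tpolarize n) (q := 3) pp n0 be DOg) => //.
  + move=> i j s1 iN jN sz r10 r12 r13 r14.
    apply: (runs_imp (polarize_runs _ _ iN jN sz r10 r12 r13 r14)).
    * by move=> a b ab; rewrite /eval_oracle (vec_eq e ab).
    * by move=> a; apply: size_coords.
    by move=> s2 _ [h1 h2]; split=> // k kn; rewrite h1 // S.
  + apply: leq_trans (HC n _ n0 (l_gt0 p pp)) _.
    by rewrite leq_mul2r leq_addr orbT.
  + by rewrite mulnA mulnn mulnC leq_mul2r leq_addl orbT.
  + by apply: iff_sym; exact: (ea_equivalent_square pp n0 be DOg po).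
- have [C HC] : bounded 7 (fun n l => 20 + Tfor n 1 + (Tfor n (Tfor n (Tmultiply n))
      + (Tdecision n l.+1 + 2)))%N.
    apply: bounded_total; rewrite /Tmultiply; bnd.
  exists (decide_program multiply), (C + 3)%N => p n F e g pp po n0 be DOg _.
  apply: (decide_program_decides (T := Tmultiply n) (q := 1) pp n0 be DOg) => //.
  + move=> i j s1 iN jN sz r10 r12 r13 r14.
    apply: (runs_imp (multiply_runs _ _ iN jN sz r10 r12 r13 r14)).
    * move=> a b ab; rewrite /mul_oracle; congr (coords _ (star _ _ _)); apply:
        vec_eq => k kn; apply: ab.
        by rewrite ltn_addr.
      by rewrite ltn_add2l.
    * by move=> a; apply: size_coords.
    move=> s2 _ [h1 h2]; split=> // k kn; rewrite h1 // /mul_oracle.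
    rewrite -(vec_delta_nat e iN) -(vec_delta_nat e jN).
    congr (nth _ (coords _ (star _ _ _)) _); apply: vec_eq => m mn.
      by rewrite [m == (n + j)%N]ltn_eqF ?orbF // ltn_addr.
    by rewrite eqn_add2l gtn_eqF // ltn_addr.
  + apply: leq_trans (HC n _ n0 (l_gt0 p pp)) _.
    by rewrite leq_mul2r leq_addr orbT.
  + by rewrite mulnA mulnn muln1 leq_pmull // addn_gt0 orbT.
  + split; first exact: strongly_isotopic_isotopic.
    exact: (isotopic_strongly_isotopic (star_comm g) (star_linear pp DOg)
      (unit_neq0 n0 be)).
Qed.
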